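(* Let $k\in\mathbb N$, $k\ge2$, and let $E$ be a symmetric space with the Fatou property. If $E^d$ is compactly fully $k$-rotund, then $E$ is $K$-order continuous.
   Context: Let $I=[0,\alpha)$, $\alpha=1$ or $\alpha=\infty$, with Lebesgue measure $\mu$, and $L^0$ the set of (classes of) extended real valued measurable functions on $I$. A Banach function space $(E,\|\cdot\|_E)$ is a Banach lattice that is a sublattice of $L^0$ such that (1) if $x\in L^0$, $y\in E$, $|x|\le|y|$ a.e., then $x\in E$ and $\|x\|_E\le\|y\|_E$; (2) there is a strictly positive $x\in E$. $E^+=\{x\in E:x\ge0\}$; $S_E$ is the unit sphere. Fatou property: if $(x_n)\subset E^+$, $\sup_n\|x_n\|_E<\infty$ and $x_n\uparrow x\in L^0$, then $x\in E$ and $\|x_n\|_E\uparrow\|x\|_E$. For $x\in L^0$: $d_x(\lambda)=\mu\{s\in I:|x(s)|>\lambda\}$, $x^*(t)=\inf\{\lambda>0:d_x(\lambda)\le t\}$, $x^{**}(t)=\frac1t\int_0^t x^*(s)\,ds$. A symmetric space is a Banach function space $E$ such that $x\in L^0$, $y\in E$, $d_x=d_y$ imply $x\in E$ and $\|x\|_E=\|y\|_E$. $x\prec y$ means $x^{**}(t)\le y^{**}(t)$ for all $t>0$. $E^d=\{x^*:x\in E\}$ (the cone of nonnegative decreasing elements). $E^d$ is compactly fully $k$-rotund if every sequence $(x_n)\subset S_E\cap E^d$ such that $\|\sum_{i=1}^k x_{n,i}\|_E\to k$ as $n\to\infty$ for any $k$ subsequences $(x_{n,1})_n,\dots,(x_{n,k})_n$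 of $(x_n)$ forms a relatively compact set. $E$ is $K$-order continuous if for every $x\in E$ and every $(x_n)\subset E$ with $x_n\prec x$ for all $n$ and $x_n^*\to0$ a.e. one has $\|x_n\|_E\to0$. *)

(* Defs.v *)
From HB Require Import structures.
From mathcomp Require Import all_boot all_order all_algebra.
From mathcomp Require Import all_classical all_reals all_analysis.
From mathcomp Require Import measurable_realfun.
Set Implicit Arguments.
Unset Strict Implicit.
Unset Printing Implicit Defensive.
Import Order.TTheory GRing.Theory Num.Theory.
Import numFieldNormedType.Exports.
Local Open Scope classical_set_scope.
Local Open Scope ring_scope.

(* Elements of L^0(I), I = [0, alpha), are represented by total functions
   R -> \bar R that are measurable on I; they are only ever compared almost
   everywhere on I, so their values outside I are irrelevant. *)
Definition domI (R : realType) (alpha : \bar R) : set R :=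
  [set s | 0 <= s /\ (s%:E < alpha)%E].

(* d_f *)
Definition distr (R : realType) (alpha : \bar R) (f : R -> \bar R) (lam : R) :
    \bar R :=
  lebesgue_measure [set s | domI alpha s /\ (lam%:E < `|f s|)%E].

(* f^*; the infimum of the empty set is +oo *)
Definition rearr (R : realType) (alpha : \bar R) (f : R -> \bar R) (t : R) :
    \bar R :=
  ereal_inf [set lam%:E | lam in
    [set lam : R | 0 < lam /\ (distr alpha f lam <= t%:E)%E]].

(* f^**.  When alpha = 1, f^* vanishes on [1, +oo[, so integrating up to some
   t >= 1 amounts to integrating over I. *)
Definition maxrearr (R : realType) (alpha : \bar R) (f : R -> \bar R) (t : R) :
    \bar R :=
  ((t^-1)%:E * \int[lebesgue_measure]_(s in `[0%R, t]) rearr alpha f s)%E.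

(* f \prec g *)
Definition hlp_le (R : realType) (alpha : \bar R) (f g : R -> \bar R) : Prop :=
  forall t : R, 0 < t -> (maxrearr alpha f t <= maxrearr alpha g t)%E.

(* The space is an abstract Banach space E together with a map [fn] choosing a
   representative of the class in L^0(I) of each vector. "f belongs to E" is
   then [exists x, fn x = f %[ae ...]].  Elements of E are finite a.e., which
   gives a meaning to the pointwise sum of representatives. *)
Record banach_function_space (R : realType) (alpha : \bar R)
    (E : completeNormedModType R) (fn : E -> R -> \bar R) : Prop := {
  bfs_measurable : forall x, measurable_fun (domI alpha) (fn x) ;
  bfs_finite : forall x,
    {ae lebesgue_measure, forall s, domI alpha s -> fn x s \is a fin_num} ;
  bfs_inj : forall x y,
    fn x = fn y %[ae lebesgue_measure in domI alpha] -> x = y ;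
  bfs_add : forall x y,
    fn (x + y) = (fun s => (fn x s + fn y s)%E)
      %[ae lebesgue_measure in domI alpha] ;
  bfs_scale : forall (a : R) x,
    fn (a *: x) = (fun s => (a%:E * fn x s)%E)
      %[ae lebesgue_measure in domI alpha] ;
  bfs_join : forall x y, exists z,
    fn z = (fun s => maxe (fn x s) (fn y s))
      %[ae lebesgue_measure in domI alpha] ;
  bfs_meet : forall x y, exists z,
    fn z = (fun s => mine (fn x s) (fn y s))
      %[ae lebesgue_measure in domI alpha] ;
  bfs_ideal : forall (f : R -> \bar R) (y : E),
    measurable_fun (domI alpha) f ->
    {ae lebesgue_measure, forall s, domI alpha s -> (`|f s| <= `|fn y s|)%E} ->
    exists x, fn x = f %[ae lebesgue_measure in domI alpha] /\ `|x| <= `|y| ;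
  bfs_weak_unit : exists x,
    {ae lebesgue_measure, forall s, domI alpha s -> (0 < fn x s)%E} }.

Definition symmetric_space (R : realType) (alpha : \bar R)
    (E : completeNormedModType R) (fn : E -> R -> \bar R) : Prop :=
  banach_function_space alpha fn /\
  forall (f : R -> \bar R) (y : E),
    measurable_fun (domI alpha) f ->
    (forall lam, distr alpha f lam = distr alpha (fn y) lam) ->
    exists x, fn x = f %[ae lebesgue_measure in domI alpha] /\ `|x| = `|y|.

Definition fatou_property (R : realType) (alpha : \bar R)
    (E : completeNormedModType R) (fn : E -> R -> \bar R) : Prop :=
  forall (u : nat -> E) (f : R -> \bar R),
    (forall n,
      {ae lebesgue_measure, forall s, domI alpha s -> (0 <= fn (u n) s)%E}) ->
    (exists M : R, forall n, `|u n| <= M) ->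
    measurable_fun (domI alpha) f ->
    {ae lebesgue_measure, forall s, domI alpha s ->
      nondecreasing_seq (fun n => fn (u n) s) /\
      (fn (u n) s @[n --> \oo] --> f s)} ->
    exists x, [/\ fn x = f %[ae lebesgue_measure in domI alpha],
      nondecreasing_seq (fun n => `|u n|) & `|u n| @[n --> \oo] --> `|x| ].

(* E^d *)
Definition decr_cone (R : realType) (alpha : \bar R)
    (E : completeNormedModType R) (fn : E -> R -> \bar R) : set E :=
  [set y | exists x : E,
    fn y = rearr alpha (fn x) %[ae lebesgue_measure in domI alpha]].

(* [precompact] is relative compactness: [precompact A = compact (closure A)]
   ([precompactE]). *)
Definition compactly_fully_rotund (R : realType) (k : nat)
    (E : completeNormedModType R) (C : set E) : Prop :=
  forall u : nat -> E,
    (forall n, C (u n) /\ `|u n| = 1) ->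
    (forall phi : 'I_k -> nat -> nat,
      (forall i, {homo phi i : m n / (m < n)%N}) ->
      `|\sum_(i < k) u (phi i n)| @[n --> \oo] --> (k%:R : R)) ->
    precompact (range u).

Definition K_order_continuous (R : realType) (alpha : \bar R)
    (E : completeNormedModType R) (fn : E -> R -> \bar R) : Prop :=
  forall (x : E) (u : nat -> E),
    (forall n, hlp_le alpha (fn (u n)) (fn x)) ->
    {ae lebesgue_measure, forall s, domI alpha s ->
      rearr alpha (fn (u n)) s @[n --> \oo] --> 0%E} ->
    `|u n| @[n --> \oo] --> (0 : R).

(* Main.v *)
(* A norm-one sequence of decreasing functions [z n] tending a.e. to [0]
   whose [k]-fold sums all satisfy [|z (f 1) + ... + z (f k)| >= k |z (f
   i)|] for some [i] would, by rotundity, have a norm cluster point; that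
   point must be the a.e. limit [0], which is absurd. Hence any such
   sequence of decreasing functions has norms tending to [0].

   Let [h = x^*]. This applies to the truncations [h 1_(0, 1/n]], which are
   pointwise ordered, and (when [alpha = +oo]) to the functions obtained
   from [h] by replacing it on [(0, n]] with its mean there, which are
   ordered by the Hardy-Littlewood-Polya relation. The Fatou property makes
   the norm monotone for that relation on decreasing functions: the lower
   step function of the smaller one is, up to a factor [1 - e], majorized by
   a fine lower step function of the larger one, and majorized vectors are
   reached by averaging permutations.

   If now [x_n^* -> 0] with [x_n] dominated by [x], then the excess of
   [x_n^*] over its value at a small [t] is dominated by [h 1_(0, t]], and
   what remains is bounded by [x_n^*(t) -> 0], hence is eventually dominated
   by a flattened [h]. *)
Require Import Defs.
From mathcomp Require Import all_boot all_order all_algebra.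
From mathcomp Require Import all_classical all_reals all_analysis.
From mathcomp Require Import perm measurable_realfun.
From mathcomp Require Import ring lra.
Import Order.TTheory GRing.Theory Num.Theory.
Import numFieldNormedType.Exports.
Local Open Scope classical_set_scope.
Local Open Scope ring_scope.
Set Implicit Arguments.
Unset Strict Implicit.
Unset Printing Implicit Defensive.

(** * Real-valued representatives *)

(** When [alpha] is infinite, nothing in the axioms keeps the constant 1 out of E, and for such a
    space x^* need not vanish at infinity and its means need not tend to 0. Rotundity is therefore
    used a first time to exclude 1 ([no_unit]); from this follow superlevel sets of finite measure
    and decreasing representatives with limit 0. Integrability is delicate in the same way: x^*
    could a priori have infinite integral near 0, so integrals stay in the extended reals until
    monotonicity of the norm for the Hardy-Littlewood-Polya relation shows that they are finite. The
    factor 1 - e has this origin too: right-endpoint lower sums say nothing about the first cell,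
    and shrinking the smaller function leaves room to drop that cell. A norm cluster point is
    identified with the a.e. limit through lower envelopes of tails, without extracting a.e.
    convergent subsequences. *)

Definition rep (R : realType) (alpha : \bar R) (E : completeNormedModType R)
    (fn : E -> R -> \bar R) (z : E) (g : R -> R) :=
  {ae lebesgue_measure, forall s, domI alpha s -> fn z s = (g s)%:E}.

#[local] Instance ae_lebesgue_filter (R : realType) :
  Filter (almost_everywhere (@lebesgue_measure R)).
Proof. exact: ae_filter_ringOfSetsType. Qed.

Section lattice.
Variables (R : realType) (alpha : \bar R).
Hypothesis halpha : alpha = 1%E \/ alpha = +oo%E.
Variables (E : completeNormedModType R) (fn : E -> R -> \bar R).
Hypothesis hE : symmetric_space alpha fn.

Local Notation mu := (@lebesgue_measure R).
Local Notation I := (domI alpha).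
Local Notation rep := (rep alpha fn).

Let hB : banach_function_space alpha fn := hE.1.

Lemma measurable_domI : measurable I.
Proof.
case: halpha => ->.
- rewrite (_ : domI _ = `[0, 1[%classic)//.
  by apply/seteqP; split => s; rewrite /domI/= in_itv/= lte_fin => /andP.
- rewrite (_ : domI _ = `[0, +oo[%classic)//.
  apply/seteqP; split => s; rewrite /domI/= in_itv/= andbT; first by case.
  by split => //; exact: ltry.
Qed.

(** The origin is a null set. It is discarded throughout because a decreasing profile may blow up
    there and is given the value 0 by convention. *)
Lemma ae_pos (P : R -> Prop) : (forall s, I s -> 0 < s -> P s) ->
  {ae mu, forall s, I s -> P s}.
Proof.
move=> H; exists [set 0]; split => //; first by rewrite lebesgue_measure_set1.
move=> s /= nP; apply: contrapT => s0; apply: nP => Is; apply: H => //.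
by rewrite lt_neqAle Is.1 andbT eq_sym; apply/eqP.
Qed.

Lemma rep_add z g z' g' : rep z g -> rep z' g' ->
  rep (z + z') (fun s => g s + g' s).
Proof.
move=> h h'; near=> s => Is.
have -> : fn (z + z') s = (fn z s + fn z' s)%E.
  by move: (Is); near: s; exact: (bfs_add hB).
have -> : fn z s = (g s)%:E by move: (Is); near: s.
by have -> : fn z' s = (g' s)%:E by move: (Is); near: s.
Unshelve. all: by end_near. Qed.

Lemma rep_scale a z g : rep z g -> rep (a *: z) (fun s => a * g s).
Proof.
move=> h; near=> s => Is.
have -> : fn (a *: z) s = (a%:E * fn z s)%E.
  by move: (Is); near: s; exact: (bfs_scale hB).
by have -> : fn z s = (g s)%:E by move: (Is); near: s.
Unshelve. all: by end_near. Qed.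

Lemma rep_ext g z g' : rep z g -> (forall s, I s -> 0 < s -> g s = g' s) ->
  rep z g'.
Proof.
move=> h /ae_pos hg; near=> s => Is.
have <- : g s = g' s by move: (Is); near: s.
by move: Is; near: s.
Unshelve. all: by end_near. Qed.

Lemma rep0 : rep 0 (fun=> 0).
Proof.
have := bfs_scale hB 0 0; rewrite scale0r; apply: filterS => s + Is.
by move=> -> //; rewrite mul0e.
Qed.

Lemma rep_opp z g : rep z g -> rep (- z) (fun s => - g s).
Proof.
move=> /(rep_scale (-1)); rewrite scaleN1r => /rep_ext; apply => s _ _.
by rewrite mulN1r.
Qed.

Lemma rep_sub z g z' g' : rep z g -> rep z' g' ->
  rep (z - z') (fun s => g s - g' s).
Proof. by move=> h h'; apply: rep_add => //; exact: rep_opp. Qed.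

Lemma rep_sum n (z : 'I_n -> E) g : (forall i, rep (z i) (g i)) ->
  rep (\sum_(i < n) z i) (fun s => \sum_(i < n) g i s).
Proof.
elim: n z g => [|n IH] z g h.
  by rewrite big_ord0; apply: rep_ext rep0 _ => s _ _; rewrite big_ord0.
rewrite big_ord_recl; apply: rep_ext (rep_add (h ord0) (IH _ _ _)) _.
  by move=> i; exact: h.
by move=> s _ _; rewrite big_ord_recl.
Qed.

Lemma rep_inj z z' g : rep z g -> rep z' g -> z = z'.
Proof.
move=> h h'; apply: (bfs_inj hB); near=> s => Is.
have -> : fn z s = (g s)%:E by move: (Is); near: s.
by have -> : fn z' s = (g s)%:E by move: (Is); near: s.
Unshelve. all: by end_near. Qed.

Lemma rep_eq0 z : rep z (fun=> 0) -> z = 0.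
Proof. by move=> h; apply: rep_inj h rep0. Qed.

Lemma rep_ideal (g : R -> R) y (h : R -> R) : measurable_fun I g -> rep y h ->
  (forall s, I s -> 0 < s -> `|g s| <= `|h s|) ->
  exists z, rep z g /\ `|z| <= `|y|.
Proof.
move=> mg ry /ae_pos gh; apply: (bfs_ideal hB (f := EFin \o g)).
  exact/measurable_EFinP.
near=> s => Is.
have -> : fn y s = (h s)%:E by move: (Is); near: s.
by rewrite /= lee_fin; move: Is; near: s.
Unshelve. all: by end_near. Qed.

Lemma rep_measurable z : exists f : R -> R, rep z f /\ measurable_fun I f.
Proof.
exists (fine \o fn z); split.
  apply: filterS (bfs_finite hB z) => s fins Is /=.
  by rewrite fineK//; exact: fins.
by apply: measurableT_comp => //; exact: (bfs_measurable hB z).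
Qed.

Lemma rep_norm_le z g y h : rep z g -> rep y h ->
  (forall s, I s -> 0 < s -> `|g s| <= `|h s|) -> `|z| <= `|y|.
Proof.
move=> rz ry /ae_pos gh.
have [x [xz xy]] : exists x, fn x = fn z %[ae mu in I] /\ `|x| <= `|y|.
  apply: (bfs_ideal hB); first exact: (bfs_measurable hB z).
  near=> s => Is.
  have -> : fn y s = (h s)%:E by move: (Is); near: s.
  have -> : fn z s = (g s)%:E by move: (Is); near: s.
  by rewrite /= lee_fin; move: Is; near: s.
by rewrite -(bfs_inj hB xz).
Unshelve. all: by end_near. Qed.

Lemma measurable_superlevel (f : R -> \bar R) lam : measurable_fun I f ->
  measurable [set s | I s /\ (lam%:E < `|f s|)%E].
Proof.
move=> mf; have mI := measurable_domI.
exact: emeasurable_fun_o_infty mI (measurableT_comp (@abse_measurable R _) mf) lam%:E.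
Qed.

Lemma le_measure_ae (A B : set R) : measurable A -> measurable B ->
  {ae mu, forall s, A s -> B s} -> (mu A <= mu B)%E.
Proof.
move=> mA mB AB; have mAB : measurable (A `\` B) by exact: measurableD.
have AB0 : mu (A `\` B) = 0%E.
  apply: measure_negligible => //; apply: negligibleS AB => s [As nBs] H.
  exact/nBs/H.
have <- : mu (B `|` (A `\` B)) = mu B by exact: measureU0.
apply: le_measure; rewrite ?inE//.
  exact: measurableU.
by move=> s As; have [|] := pselect (B s); [left|right].
Qed.

Lemma ae_distr (f f' : R -> \bar R) lam : measurable_fun I f ->
  measurable_fun I f' -> f = f' %[ae mu in I] ->
  distr alpha f lam = distr alpha f' lam.
Proof.
move=> mf mf' ff'; apply/eqP; rewrite eq_le; apply/andP; split;
  (apply: le_measure_ae; [exact: measurable_superlevel..|]);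
  by apply: filterS ff' => s H [Is /= lt]; split=> //; move: lt; rewrite H.
Qed.

End lattice.

(** * Decreasing rearrangements *)

(* Only the values on ]0, alpha[ matter; extending by [0] makes such functions
   measurable on the whole line. *)
Definition decr_fun (R : realType) (alpha : \bar R) (g : R -> R) :=
  [/\ forall s, 0 <= g s,
      forall s : R, s <= 0 -> g s = 0,
      forall s t : R, 0 < s -> s <= t -> g t <= g s &
      forall s, (alpha <= s%:E)%E -> g s = 0].

Section rearrangement.
Variables (R : realType) (alpha : \bar R).
Hypothesis halpha : alpha = 1%E \/ alpha = +oo%E.

Local Notation mu := (@lebesgue_measure R).
Local Notation I := (domI alpha).

(** Superlevel sets at negative heights are the whole line; at other heights they are intervals,
    since the extension by 0 to the left never exceeds the height. *)
Lemma decr_measurable g (D : set R) : decr_fun alpha g -> measurable D ->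
  measurable_fun D g.
Proof.
move=> [g0 gN gd _] mD; apply: (@measurable_funS _ _ _ _ setT) => //.
apply: (measurability _ (RGenOInfty.measurableE R)) => //.
move=> _ [_ [a ->] <-]; rewrite setTI.
have [a0|a0] := ltP a 0.
  rewrite (_ : _ @^-1` _ = setT)//; apply/seteqP; split => // s _ /=.
  by rewrite in_itv/= andbT (lt_le_trans a0).
apply: is_interval_measurable => s t /=; rewrite !in_itv/= !andbT.
move=> as_ at_ u /andP[su ut]; rewrite in_itv/= andbT.
have s0 : 0 < s by rewrite ltNge; apply/negP => /gN e; move: as_; rewrite e ltNge a0.
by apply: lt_le_trans at_ _; apply: gd => //; exact: lt_le_trans su.
Qed.

(** A bad point [s] has a rational [q] with [g s] above [q] and [g] at most [q] to the right of [s].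
    Each [q] serves at most one [s], so the bad points are countable. *)
Lemma decr_ae_right_cts g : decr_fun alpha g ->
  {ae mu, forall s : R, 0 < s ->
    forall a, a < g s -> exists2 t : R, s < t & a < g t}.
Proof.
move=> [g0 gN gd _].
pose B (q : rat) := [set s | [/\ 0 < s, ratr q < g s &
  forall t, s < t -> g t <= ratr q]].
have cB : countable (\bigcup_q B q).
  apply: bigcup_countable => // q _; apply: finite_set_countable.
  have [[x Bx]|nB] := pselect (exists x, B q x).
    apply: (sub_finite_set (B := [set x])) => //.
    move=> s Bs /=; case: Bs Bx => s0 gs Hs [x0 gx Hx].
    case: (ltgtP s x) => // [sx|xs].
      by move: (Hs _ sx); rewrite leNgt gx.
    by move: (Hx _ xs); rewrite leNgt gs.
  rewrite (_ : B q = set0)//; apply/seteqP; split => // s Bs.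
  by apply: nB; exists s.
exists (\bigcup_q B q); split.
- apply: countable_measurable => //.
- exact: countable_lebesgue_measure0.
move=> s /= /existsNP[sp /existsNP[a /not_implyP[ag H]]].
have [q /andP[aq qg]] : exists q : rat, a < ratr q < g s.
  by have [q] := rat_in_itvoo ag; rewrite in_itv/=; exists q.
exists q => //; split => // t st; rewrite leNgt; apply/negP => qt.
by apply: H; exists t => //; exact: lt_trans qt.
Qed.

Lemma distr_le (f : R -> \bar R) lam lam' : measurable_fun I f -> lam <= lam' ->
  (distr alpha f lam' <= distr alpha f lam)%E.
Proof.
move=> mf ll; apply: le_measure; rewrite ?inE; [exact: measurable_superlevel..|].
by move=> s /= [Is h]; split => //; apply: le_lt_trans h; rewrite lee_fin.
Qed.

(** Continuity of measure from below: the strict superlevel set at [lam] is the increasing union of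
    those at [lam + 1/(n+1)]. *)
Lemma distr_right_cts (f : R -> \bar R) lam (c : \bar R) : measurable_fun I f ->
  (forall lam', lam < lam' -> (distr alpha f lam' <= c)%E) ->
  (distr alpha f lam <= c)%E.
Proof.
move=> mf H; pose F n := [set s | I s /\ ((lam + n.+1%:R^-1)%:E < `|f s|)%E].
have UF : [set s | I s /\ (lam%:E < `|f s|)%E] = \bigcup_n F n.
  apply/seteqP; split => [s [Is lf]|s [n _ [Is h]]]; last first.
    by split => //; apply: le_lt_trans h; rewrite lee_fin lerDl invr_ge0.
  case E : (`|f s|)%E lf => [r| |]//; last by exists 0%N => //; split; rewrite ?E ?ltry.
  rewrite lte_fin => lr; have rl : 0 < r - lam by rewrite subr_gt0.
  exists (Num.truncn (r - lam)^-1) => //; split => //; rewrite E lte_fin.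
  rewrite -ltrBrDl invf_plt ?posrE//.
  exact: truncnS_gt.
have ndF : nondecreasing_seq F.
  move=> m n mn; apply/subsetPset => s [Is h]; split => //.
  apply: le_lt_trans h; rewrite lee_fin lerD2l lef_pV2 ?posrE// ler_nat ltnS//.
have mF n : measurable (F n) by exact: measurable_superlevel.
have := @nondecreasing_cvg_mu _ _ _ mu F mF (bigcup_measurable (fun n _ => mF n)) ndF.
rewrite -UF => cv.
apply: (closed_cvg (fun x => x <= c)%E _ _ _ cv); first exact: closed_ereal_ge_ereal.
by apply: nearW => n /=; apply: H; rewrite ltrDl invr_gt0.
Qed.

(** The Galois connection between f^* and d_f, which afterwards replaces every computation with the
    infimum. Passing from right to left needs right continuity of d_f. *)
Lemma rearr_gt (f : R -> \bar R) lam t : measurable_fun I f -> 0 <= lam ->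
  (lam%:E < rearr alpha f t)%E = (t%:E < distr alpha f lam)%E.
Proof.
move=> mf l0; apply/idP/idP; last first.
  apply: contraTT; rewrite -!leNgt => H.
  apply: distr_right_cts => // lam' ll'.
  have /ereal_inf_lt[_ [l'' [l''0 dl''] <-]] : (rearr alpha f t < lam'%:E)%E.
    by apply: le_lt_trans H _; rewrite lte_fin.
  by rewrite lte_fin => /ltW; move/(distr_le mf) => /le_trans; apply.
apply: contraTT; rewrite -!leNgt => H.
apply/lee_addgt0Pr => e e0; apply: ereal_inf_lbound.
exists (lam + e) => //; split; first by rewrite ltr_wpDl.
by apply: le_trans H; apply: distr_le => //; rewrite lerDl ltW.
Qed.

Lemma rearr_ge0 (f : R -> \bar R) t : (0 <= rearr alpha f t)%E.
Proof. by apply: le_ereal_inf_tmp => _ [l [l0 _] <-]; rewrite lee_fin ltW. Qed.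

Lemma distr_le_alpha (f : R -> \bar R) lam : measurable_fun I f ->
  (distr alpha f lam <= alpha)%E.
Proof.
move=> mf; case: halpha => e; last by rewrite {2}e leey.
have E : alpha = mu `[0, 1]%classic.
  by rewrite lebesgue_measure_itv/= lte_fin ltr01 e oppr0 adde0.
rewrite [leRHS]E; apply: le_measure; rewrite ?inE//.
  exact: measurable_superlevel.
by move=> s [[s0]]; rewrite {1}e lte_fin => s1 _ /=; rewrite in_itv/= s0 ltW.
Qed.

(** The superlevel sets shrink to the set where [f] is infinite, which is null; continuity from
    above needs one of them to have finite measure. *)
Lemma distr_small (f : R -> \bar R) (t : R) : measurable_fun I f ->
  {ae mu, forall s, I s -> f s \is a fin_num} ->
  (exists lam, (distr alpha f lam < +oo)%E) -> 0 < t ->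
  exists2 lam, 0 < lam & (distr alpha f lam <= t%:E)%E.
Proof.
move=> mf ff [l0 dl0] t0.
(* The shift by the absolute value of [l0] makes already the first set finite in measure. *)
pose F n := [set s | I s /\ ((`|l0| + n.+1%:R)%:E < `|f s|)%E].
have niF : nonincreasing_seq F.
  move=> m n mn; apply/subsetPset => s [Is h]; split => //.
  by apply: le_lt_trans h; rewrite lee_fin lerD2l ler_nat ltnS.
have mF n : measurable (F n) by exact: measurable_superlevel.
have F0 : (mu (F 0%N) < +oo)%E.
  apply: le_lt_trans dl0; apply: distr_le => //.
  by rewrite (le_trans (ler_norm _))// lerDl.
have muF : mu (\bigcap_n F n) = 0%E.
  apply: measure_negligible; first exact: bigcapT_measurable.
  apply: (negligibleS _ ff) => s H Hs.
  have [Is _] := H 0%N Logic.I.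
  have := Hs Is; case E : (f s) => [r| |]// _.
  have [_] := H (Num.truncn `|r|) Logic.I.
  rewrite E /= lte_fin ltNge => /negP; apply.
  by rewrite (le_trans (ltW (truncnS_gt _)))// lerDr.
have cv : mu \o F @ \oo --> 0%E.
  rewrite -muF; apply: nonincreasing_cvg_mu => //.
  exact: bigcapT_measurable.
have nb : nbhs (0%E : \bar R) [set x | (x < t%:E)%E].
  apply: open_nbhs_nbhs; split; first exact: open_ereal_lt_ereal.
  by rewrite /= lte_fin.
have [n _ /(_ n (leqnn n)) /= Fn] := cv _ nb.
exists (`|l0| + n.+1%:R); last exact: ltW.
by rewrite ltr_wpDl.
Qed.

(** The two can differ only where [g] is not right continuous: the superlevel set at height [g s]
    lies in [0, s], while right continuity at [s] makes superlevel sets at lower heights reach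
    beyond [s]. *)
Lemma rearr_decr g : decr_fun alpha g ->
  rearr alpha (EFin \o g) = EFin \o g %[ae mu in I].
Proof.
move=> dg; have [g0 gN gd ga] := dg; have mI := measurable_domI halpha.
have mg : measurable_fun I (EFin \o g).
  by apply/measurable_EFinP; exact: decr_measurable dg mI.
have := ae_pos (alpha := alpha) (P := fun s => 0 < s) (fun _ _ => id).
apply: filterS2 (decr_ae_right_cts dg) => s H s0 Is.
have {}H := H (s0 Is); have {}s0 := s0 Is.
have dom0 (u r : R) : 0 < u -> u <= r -> I r -> I u.
  move=> u0 ur [_ ra]; split; first exact: ltW.
  by apply: le_lt_trans ra; rewrite lee_fin.
apply/eqP; rewrite eq_le; apply/andP; split.
  rewrite leNgt; apply/negP; rewrite /= rearr_gt//.
  apply/negP; rewrite -leNgt.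
  have -> : s%:E = mu `[0, s]%classic.
    by rewrite lebesgue_measure_itv/= lte_fin s0 oppr0 adde0.
  apply: le_measure; rewrite ?inE//; first exact: measurable_superlevel.
  move=> u [[u0 ua]] /=; rewrite lte_fin ger0_norm// in_itv/= u0/= => gu.
  by rewrite leNgt; apply/negP => su; move: gu; rewrite ltNge gd// ltW.
rewrite leNgt; apply/negP => lt.
have : (0 <= rearr alpha (EFin \o g) s)%E by exact: rearr_ge0.
case E : (rearr _ _ _) lt => [r| |]//; rewrite lte_fin lee_fin => rs r0.
have [t st rt] := H _ rs.
have : (r%:E < rearr alpha (EFin \o g) s)%E; last by rewrite E ltxx.
rewrite rearr_gt//.
apply: (@lt_le_trans _ _ (mu `[0, t[%classic)).
  by rewrite lebesgue_measure_itv/= lte_fin (lt_trans s0 st) oppr0 adde0 lte_fin.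
rewrite -(_ : mu `]0, t[%classic = mu `[0, t[%classic); last first.
  by rewrite !lebesgue_measure_itv.
apply: le_measure; rewrite ?inE//; first exact: measurable_superlevel.
move=> u /=; rewrite in_itv/= => /andP[u0 ut]; split.
  apply: (@dom0 _ t) => //; first exact: ltW.
  split; first by rewrite ltW// (lt_trans s0).
  rewrite ltNge; apply/negP => /ga gt0; move: rt; rewrite gt0 ltNge r0//.
rewrite lte_fin ger0_norm//; apply: lt_le_trans rt _.
by apply: gd => //; exact: ltW.
Qed.

End rearrangement.

(** * Equimeasurable functions, norm cluster points and Fatou limits *)

Section limits.
Variables (R : realType) (alpha : \bar R).
Hypothesis halpha : alpha = 1%E \/ alpha = +oo%E.
Variables (E : completeNormedModType R) (fn : E -> R -> \bar R).
Hypothesis hE : symmetric_space alpha fn.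
Hypothesis hF : fatou_property alpha fn.

Local Notation mu := (@lebesgue_measure R).
Local Notation I := (domI alpha).
Local Notation rep := (rep alpha fn).

Let hB : banach_function_space alpha fn := hE.1.

Lemma rep_equi (g : R -> R) y (h : R -> R) :
  measurable_fun I g -> measurable_fun I h -> rep y h ->
  (forall lam, 0 <= lam ->
    distr alpha (EFin \o g) lam = distr alpha (EFin \o h) lam) ->
  exists z, rep z g /\ `|z| = `|y|.
Proof.
move=> mg mh ry gh; apply: (hE.2 (EFin \o g)); first exact/measurable_EFinP.
move=> lam.
have -> : distr alpha (fn y) lam = distr alpha (EFin \o h) lam.
  apply: ae_distr => //; first exact: (bfs_measurable hB).
  exact/measurable_EFinP.
have [l0|l0] := leP 0 lam; first exact: gh.
congr (mu _); apply/seteqP; split => s /= [Is _]; split => //;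
  by rewrite lte_fin (lt_le_trans l0).
Qed.

Lemma le_einfs (u : (\bar R)^nat) m n : (m <= n)%N -> (einfs u m <= u n)%E.
Proof. by move=> mn; apply: ereal_inf_lbound; exists n. Qed.

Lemma einfs_abse_ge0 (u : (\bar R)^nat) m : (0 <= einfs (fun n => `|u n|) m)%E.
Proof. by apply: le_ereal_inf_tmp => _ [n _ <-]. Qed.

(** The lower envelope of a tail belongs to E by the ideal property, and its norm is below every
    norm in the tail. Both limit lemmas that follow rest on this. *)
Lemma einfs_ideal (z : nat -> E) m : exists x,
  fn x = (fun s => einfs (fun n => `|fn (z n) s|)%E m) %[ae mu in I] /\
  forall n, (m <= n)%N -> `|x| <= `|z n|.
Proof.
have H n : (m <= n)%N -> exists x,
    fn x = (fun s => einfs (fun n => `|fn (z n) s|)%E m) %[ae mu in I] /\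
    `|x| <= `|z n|.
  move=> mn; apply: (bfs_ideal hB).
    apply: measurable_fun_einfs => k; apply: measurableT_comp => //.
    exact: (bfs_measurable hB).
  apply: aeW => s Is; rewrite gee0_abs ?einfs_abse_ge0//.
  exact: le_einfs.
have [x [xe _]] := H m (leqnn m).
exists x; split => // n /H[x' [xe' ?]].
rewrite (_ : x = x')//; apply: (bfs_inj hB).
by apply: filterS2 xe xe' => s xs xs' Is; rewrite xs// xs'.
Qed.

(** The lower envelope of the tail of |w - z n| has norm below each of these distances, some of
    which are arbitrarily small, so it vanishes a.e. But these envelopes converge a.e. to |w -
    g'|. *)
Lemma rep_cluster (z : nat -> E) (g : nat -> R -> R) (w : E) (g' : R -> R) :
  (forall n, rep (z n) (g n)) ->
  {ae mu, forall s, I s -> g n s @[n --> \oo] --> g' s} ->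
  (forall e, 0 < e -> forall m, exists2 n, (m <= n)%N & `|w - z n| < e) ->
  rep w g'.
Proof.
move=> rz gg' cl.
have F0 m : {ae mu, forall s, I s ->
    einfs (fun n => `|fn (w - z n)%R s|)%E m = 0%E}.
  have [x [xe xn]] := einfs_ideal (fun n => w - z n)%R m.
  have x0 : x = 0.
    apply/eqP; rewrite -normr_eq0; apply/negPn/negP => nx.
    have [|n mn] := cl `|x| _ m; first by rewrite lt_neqAle eq_sym nx normr_ge0.
    by rewrite ltNge xn.
  have := rep0 hE; rewrite -x0; apply: filterS2 xe => s xs x0s Is.
  by rewrite -xs// x0s.
have [fw [rw mfw]] := rep_measurable hE w.
have rwz : {ae mu, forall s, forall n, I s ->
    fn (w - z n) s = (fw s - g n s)%:E}.
  by apply: ae_foralln => n; exact: (rep_sub hE).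
have {}F0 := ae_foralln F0.
have H : {ae mu, forall s, I s -> fw s = g' s}.
  apply: filterS3 gg' F0 rwz => s gs Fs rs Is.
  have cv : (`|(fw s - g n s)%:E|%E @[n --> \oo] --> `|fw s - g' s|%:E)%E.
    apply: (@cvg_EFin _ _ _ _ _); first by near=> n.
    by apply: cvg_norm; apply: cvgB; [exact: cvg_cst|exact: gs].
  have E0 : einfs (fun n => `|(fw s - g n s)%:E|%E) = fun=> 0%E.
    apply/funext => m; rewrite -(Fs m Is); congr (einfs _ m).
    by apply/funext => n; rewrite rs.
  have : (`|fw s - g' s|%:E = 0 :> \bar R)%E.
    by rewrite -(cvg_lim (@ereal_hausdorff R) (cvg_einfs cv)) E0 lim_cst.
  by case=> /normr0_eq0/eqP; rewrite subr_eq0 => /eqP.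
by apply: filterS2 rw H => s ws hs Is; rewrite ws// hs.
Unshelve. all: by end_near. Qed.

(** The tail envelopes of |z n| increase a.e. to |y| and their norms stay below [C], so the Fatou
    property, stated for monotone sequences, applies to them. *)
Lemma rep_fatou (z : nat -> E) (g : nat -> R -> R) y (g' : R -> R) C :
  (forall n, rep (z n) (g n)) -> (forall n, `|z n| <= C) ->
  {ae mu, forall s, I s -> g n s @[n --> \oo] --> g' s} ->
  rep y g' -> `|y| <= C.
Proof.
move=> rz zC gg' ry.
have H m := einfs_ideal z m.
pose x m := sval (cid (H m)).
have xe m : fn (x m) = (fun s => einfs (fun n => `|fn (z n) s|)%E m)
    %[ae mu in I].
  exact: (svalP (cid (H m))).1.
have xC m : `|x m| <= C.
  exact: le_trans ((svalP (cid (H m))).2 m (leqnn m)) (zC m).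
have {}xe := ae_foralln xe; have {}rz := ae_foralln rz.
have [||||v [ve _ xv]] := @hF x (abse \o fn y).
- move=> n; apply: filterS xe => s xs Is.
  by rewrite xs//; exact: einfs_abse_ge0.
- by exists C.
- by apply: measurableT_comp => //; exact: (bfs_measurable hB).
- have rz' : {ae mu, forall s, (forall n, I s -> fn (z n) s = (g n s)%:E) /\
      (I s -> fn y s = (g' s)%:E)} by exact: filterI.
  apply: filterS3 xe rz' gg' => s xs [zs ys] gs Is; split.
    move=> m n mn; rewrite !xs//; exact: nondecreasing_einfs.
  rewrite (_ : (fun n => _) = einfs (fun n => `|fn (z n) s|)%E); last first.
    by apply/funext => n; rewrite xs.
  apply: cvg_einfs; rewrite /= ys//.
  rewrite (_ : (fun n => _) = (fun n => `|g n s|%:E)); last first.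
    by apply/funext => n; rewrite zs.
  apply: (@cvg_EFin _ _ _ _ _); first by near=> n.
  by apply: cvg_norm; exact: gs.
have vC : `|v| <= C.
  by apply: (closed_cvg (fun r => r <= C) _ _ _ xv); [exact: closed_le|exact: nearW].
apply: le_trans vC.
have [fy [ryf mfy]] := rep_measurable hE y.
apply: (rep_norm_le hE ryf (h := fun s => `|fy s|)).
  by apply: filterS2 ve ryf => s vs ys Is; rewrite vs//= ys.
by move=> s _ _; rewrite normr_id.
Unshelve. all: by end_near. Qed.

Lemma rep_decr_cone z g : rep z g -> decr_fun alpha g -> decr_cone alpha fn z.
Proof.
move=> rz dg; exists z.
have -> : rearr alpha (fn z) = rearr alpha (EFin \o g).
  apply/funext => t; rewrite /rearr; congr (ereal_inf _).
  have dz : distr alpha (fn z) = distr alpha (EFin \o g).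
    apply/funext => lam; apply: ae_distr => //.
      exact: (bfs_measurable hB).
    by apply/measurable_EFinP; exact: decr_measurable dg (measurable_domI halpha).
  by rewrite dz.
apply: filterS2 rz (rearr_decr halpha dg) => s zs rs Is.
by rewrite zs// rs.
Qed.

End limits.

(** * Sequences in the decreasing cone *)

Lemma ae_exists_itv (R : realType) (P : R -> Prop) (a b : R) :
  {ae @lebesgue_measure R, forall s, P s} -> a < b ->
  exists2 s, a < s < b & P s.
Proof.
move=> aeP ab; apply: contrapT => H.
have : (@lebesgue_measure R `]a, b[%classic = 0)%E.
  apply: measure_negligible => //; apply: negligibleS aeP => s.
  by rewrite /= in_itv/= => sab Ps; apply: H; exists s.
rewrite lebesgue_measure_itv/= lte_fin ab => -[/eqP].
by rewrite subr_eq0 gt_eqF.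
Qed.

Section rotundity.
Variables (R : realType) (alpha : \bar R).
Hypothesis halpha : alpha = 1%E \/ alpha = +oo%E.
Variables (E : completeNormedModType R) (fn : E -> R -> \bar R).
Hypothesis hE : symmetric_space alpha fn.

Local Notation mu := (@lebesgue_measure R).
Local Notation I := (domI alpha).
Local Notation rep := (rep alpha fn).

Lemma rep_norm_gt0 z g s : rep z g -> decr_fun alpha g -> 0 < g s -> 0 < `|z|.
Proof.
move=> rz [g0 gN gd ga] gs.
have s0 : 0 < s by rewrite ltNge; apply/negP => /gN e; rewrite e ltxx in gs.
rewrite normr_gt0; apply/negP => /eqP z0; move: rz (rep0 hE); rewrite z0 => rz r0.
have H : {ae mu, forall s, I s -> g s = 0}.
  by apply: filterS2 rz r0 => t zt t0 It; move: (zt It); rewrite t0// => -[].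
have [t /andP[t0 ts] gt] := ae_exists_itv H s0.
have gst : g s <= g t by apply: gd => //; exact: ltW.
have gt0 : 0 < g t by exact: lt_le_trans gst.
suff e : g t = 0 by rewrite e ltxx in gt0.
apply: gt; split; first exact: ltW.
by rewrite ltNge; apply/negP => /ga e; rewrite e ltxx in gt0.
Qed.

Variable k : nat.
Hypothesis hk : (2 <= k)%N.
Hypothesis hrot : compactly_fully_rotund k (decr_cone alpha fn).

Let k0 : 0 < k%:R :> R. Proof. by rewrite ltr0n (leq_trans _ hk). Qed.

(** Rotundity speaks of unit vectors, so the sequence is normalized. As the norms converge to [c],
    rescaling by [c] costs little both in the sums and in the distance to the cluster point. The
    index family [f] is arbitrary because the [k] subsequences are unrelated. *)
Lemma rotund_cluster (z : nat -> E) (g : nat -> R -> R) (g' : R -> R) (c : R) :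
  (forall n, rep (z n) (g n)) -> (forall n, decr_fun alpha (g n)) ->
  {ae mu, forall s, I s -> g n s @[n --> \oo] --> g' s} ->
  `|z n| @[n --> \oo] --> c -> 0 < c -> (forall n, 0 < `|z n|) ->
  (forall f : 'I_k -> nat, exists i,
    k%:R * `|z (f i)| <= `|\sum_(i < k) z (f i)|) ->
  exists w, [/\ rep w g', `|w| = c &
    forall e : R, 0 < e -> forall m, exists2 n, (m <= n)%N & `|w - z n| < e].
Proof.
move=> rz dg gg' zc c0 z0 zk.
pose u n := `|z n|^-1 *: z n.
have nu n : `|u n| = 1.
  by rewrite normrZ normfV normr_id mulVf// gt_eqF.
have zu n : z n = `|z n| *: u n.
  by rewrite scalerA mulfV ?scale1r// gt_eqF.
have uC n : decr_cone alpha fn (u n) /\ `|u n| = 1.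
  split => //; apply: (rep_decr_cone halpha hE (rep_scale hE _ (rz n))).
  have [g0 gN gd ga] := dg n.
  have iz : 0 <= `|z n|^-1 by rewrite invr_ge0.
  split => [s|s /gN ->|s t s0 st|s /ga ->]; rewrite ?mulr0//.
    exact: mulr_ge0.
  by apply: ler_wpM2l => //; exact: gd.
suff sums (phi : 'I_k -> nat -> nat) :
    (forall i, {homo phi i : m n / (m < n)%N}) ->
    `|\sum_(i < k) u (phi i n)| @[n --> \oo] --> (k%:R : R).
  have := hrot uC sums; clear sums.
  rewrite precompactE => cpt.
  have [|w0 [_ cw]] := cpt (u @ \oo) _.
    apply: filterS (_ : range u `<=` _) _; first exact: subset_closure.
    by exists 0%N => // n _; exists n.
  have cl (e : R) : 0 < e -> forall m, exists2 n, (m <= n)%N & `|c *: w0 - z n| < e.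
    (* The error is [c * d] from the unit vectors plus [d] from replacing the norm of [z n] by
       [c]. *)
    move=> e0 m; pose d := e / (c + 1).
    have d0 : 0 < d by rewrite divr_gt0// ltr_wpDl// ltW.
    have [N _ HN] : \forall n \near \oo, `|c - `|z n| | <= d.
      by move/cvgrPdist_le : zc; apply.
    have [||_ [[n /= mn <-] un]] := cw (u @` [set n | (maxn m N <= n)%N]) (ball w0 d).
    - by exists (maxn m N) => // n /= ?; exists n.
    - exact: nbhsx_ballx.
    rewrite -ball_normE /= in un.
    exists n; first by rewrite (leq_trans _ mn)// leq_maxl.
    rewrite zu -(subrK (c *: u n) (c *: w0)) -addrA -scalerBr -scalerBl.
    apply: le_lt_trans (ler_normD _ _) _.
    rewrite [X in X + _]normrZ [X in _ + X]normrZ nu mulr1 (gtr0_norm c0).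
    have -> : e = c * d + d by rewrite /d; field; rewrite gt_eqF// ltr_wpDl// ltW.
    rewrite ltr_leD// ?ltr_pM2l//; apply: HN.
    by rewrite /= (leq_trans _ mn)// leq_maxr.
  exists (c *: w0); split => //; first exact: (rep_cluster hE rz gg' cl).
  apply/eqP; rewrite -subr_eq0 -normr_eq0; apply/negPn/negP => n0.
  set r := `|_| in n0; have r0 : 0 < r by rewrite lt_neqAle eq_sym n0 normr_ge0.
  have r2 : 0 < r / 2 by rewrite divr_gt0.
  have [N _ HN] : \forall n \near \oo, `|c - `|z n| | <= r / 2.
    by move/cvgrPdist_le : zc; apply.
  have [n Nn wz] := cl _ r2 N.
  have := HN n Nn; have := ler_dist_dist (c *: w0) (z n).
  have : r <= `| `|c *: w0| - `|z n| | + `|c - `|z n| |.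
    rewrite /r -[X in X - c](subrK `|z n|) -addrA (distrC c).
    exact: ler_normD.
  move: wz; lra.
move=> hphi.
apply/cvgrPdist_le => e e0.
(* A loss of [k * d * c] occurs twice: in the lower bound for the sum of the [z], and in passing
   from that sum to the one of the [u]. *)
pose d := e / (2 * k%:R).
have d0 : 0 < d by rewrite divr_gt0// mulr_gt0.
have [N _ HN] : \forall n \near \oo, `|c - `|z n| | <= d * c.
  by move/cvgrPdist_le : zc; apply; rewrite mulr_gt0.
exists N => // n /= Nn.
(* A strictly increasing map of the naturals dominates the identity, so every chosen index is beyond
   [N]. *)
have phin i : (n <= phi i n)%N.
  elim: n {Nn} => // n IH; apply: leq_ltn_trans IH _; exact: hphi.
have zd i : `|c - `|z (phi i n)| | <= d * c.
  by apply: HN; exact: leq_trans (phin i).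
have up : `|\sum_(i < k) u (phi i n)| <= k%:R.
  apply: le_trans (ler_norm_sum _ _ _) _.
  by under eq_bigr do rewrite nu; rewrite sumr_const card_ord.
rewrite ger0_norm ?subr_ge0//.
have [i Hi] := zk (fun i => phi i n).
have lowz : k%:R * (c - d * c) <= `|\sum_(i < k) z (phi i n)|.
  apply: le_trans Hi; rewrite ler_pM2l//.
  by have := zd i; rewrite ler_distlC => /andP[].
have diff : `|\sum_(i < k) z (phi i n)| <=
    c * `|\sum_(i < k) u (phi i n)| + k%:R * (d * c).
  rewrite -(subrK (c *: \sum_(i < k) u (phi i n)) (\sum_(i < k) z (phi i n))).
  apply: le_trans (ler_normD _ _) _.
  rewrite addrC normrZ (gtr0_norm c0) lerD2l scaler_sumr -sumrB.
  apply: le_trans (ler_norm_sum _ _ _) _.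
  apply: le_trans (_ : \sum_(i < k) (d * c) <= _); last first.
    by rewrite sumr_const card_ord mulr_natl.
  apply: ler_sum => j _; rewrite {1}zu -scalerBl normrZ nu mulr1 distrC.
  exact: zd.
have : k%:R * (c - d * c) <= c * `|\sum_(i < k) u (phi i n)| + k%:R * (d * c).
  exact: le_trans diff.
have ke : k%:R * d = e / 2 by rewrite /d; field; rewrite gt_eqF.
move: (`|_|) => U HU.
rewrite -(ler_pM2l c0).
have -> : e = 2 * (k%:R * d) by rewrite ke; field.
lra.
Qed.

End rotundity.

(** * Excluding the constant 1 when the interval is infinite *)

Section profiles.
Variables (R : realType) (alpha : \bar R).
Hypothesis halpha : alpha = 1%E \/ alpha = +oo%E.
Variables (E : completeNormedModType R) (fn : E -> R -> \bar R).
Hypothesis hE : symmetric_space alpha fn.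

Local Notation mu := (@lebesgue_measure R).
Local Notation I := (domI alpha).
Local Notation rep := (rep alpha fn).

Variable k : nat.
Hypothesis hk : (2 <= k)%N.
Hypothesis hrot : compactly_fully_rotund k (decr_cone alpha fn).

Lemma ord_argmin (f : 'I_k -> nat) : exists i, forall j, (f i <= f j)%N.
Proof.
have k0 : (0 < k)%N by exact: leq_trans hk.
by case: (@arg_minnP _ (Ordinal k0) predT f) => // i _ H; exists i => j; exact: H.
Qed.

Lemma ord_argmax (f : 'I_k -> nat) : exists i, forall j, (f j <= f i)%N.
Proof.
have k0 : (0 < k)%N by exact: leq_trans hk.
by case: (@arg_maxnP _ (Ordinal k0) predT f) => // i _ H; exists i => j; exact: H.
Qed.

Lemma rep_sum_norm_ge (z : 'I_k -> E) (g : 'I_k -> R -> R) y h :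
  (forall i, rep (z i) (g i)) -> rep y h -> (forall s, 0 <= h s) ->
  (forall i s, I s -> 0 < s -> h s <= g i s) ->
  k%:R * `|y| <= `|\sum_(i < k) z i|.
Proof.
move=> rz ry h0 hg.
have -> : k%:R * `|y| = `|k%:R *: y| by rewrite normrZ ger0_norm.
apply: (rep_norm_le hE (rep_scale hE _ ry) (rep_sum hE rz)) => s Is s0.
have le : k%:R * h s <= \sum_(i < k) g i s.
  rewrite mulr_natl -[k in _ *+ k]card_ord -sumr_const.
  by apply: ler_sum => i _; exact: hg.
by rewrite !ger0_norm// ?(le_trans _ le)// mulr_ge0.
Qed.

Hypothesis ainf : alpha = +oo%E.

Definition plateau (n : nat) (s : R) : R := ((0 < s) && (s < n.+1%:R))%:R.

Lemma plateau_decr n : decr_fun alpha (plateau n).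
Proof.
rewrite /plateau; split => [s|s s0|s t s0 st|s].
- by rewrite ler0n.
- by rewrite ltNge s0.
- rewrite s0 (lt_le_trans s0 st)/=.
  by case: (ltP t) => [/(le_lt_trans st) ->|_]//; exact: ler0n.
- by rewrite ainf leye_eq.
Qed.

Lemma distr_cst1 lam : 0 <= lam ->
  distr alpha (EFin \o (fun=> 1 : R)) lam = if lam < 1 then +oo%E else 0%E.
Proof.
move=> l0; rewrite /distr /= normr1.
case: ifPn => l1.
  rewrite (_ : [set s | _] = `[0, +oo[%classic).
    by rewrite lebesgue_measure_itv/= ltry.
  apply/seteqP; split => s; rewrite /= in_itv/= andbT; first by case=> -[].
  by move=> s0; split; [split => //; rewrite ainf ltry|rewrite lte_fin].
rewrite (_ : [set s | _] = set0) ?measure0//; apply/seteqP; split => // s /= [_].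
by rewrite lte_fin (negPf l1).
Qed.

(* Otherwise the plateaus would cluster in norm at [1], although [1 - plateau n]
   is equimeasurable with [1]. *)
Lemma no_unit z : ~ rep z (fun=> 1).
Proof.
move=> rz.
have mI := measurable_domI halpha.
have H n : exists w, rep w (plateau n) /\ `|w| <= `|z|.
  apply: (rep_ideal hE _ rz); first exact: decr_measurable (plateau_decr n) mI.
  by move=> s _ _; rewrite normr1 /plateau; case: (_ && _); rewrite ?normr1 ?normr0.
pose w n := sval (cid (H n)).
have rw n : rep (w n) (plateau n) by exact: (svalP (cid (H n))).1.
have wz n : `|w n| <= `|z| by exact: (svalP (cid (H n))).2.
have ple m n s : (m <= n)%N -> 0 < s -> 0 <= plateau m s <= plateau n s.
  move=> mn s0; rewrite /plateau s0/= ler0n/= ler_nat.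
  case: ltP => // sm; rewrite (lt_le_trans sm)// ler_nat ltnS//.
have wnd : nondecreasing_seq (fun n => `|w n|).
  move=> m n mn; apply: (rep_norm_le hE (rw m) (rw n)) => s _ s0.
  have /andP[p0 pp] := ple m n s mn s0.
  by rewrite !ger0_norm// (le_trans p0).
have w0 n : 0 < `|w n|.
  apply: (rep_norm_gt0 hE (s := 2^-1) (rw n) (plateau_decr n)).
  have h1 : (2^-1 < n.+1%:R :> R).
    by apply: (@lt_le_trans _ _ 1); [rewrite invf_lt1 ?ltr0n// ltr1n|rewrite ler1n].
  by rewrite /plateau invr_gt0 ltr0n h1 /= ltr0n.
have wcv : cvgn (fun n => `|w n|).
  by apply: nondecreasing_is_cvgn => //; exists `|z| => _ [n _ <-].
pose c := limn (fun n => `|w n|).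
have wc n : `|w n| <= c by exact: nondecreasing_cvgn_le.
have [||||v [rv vc cl]] := rotund_cluster halpha hE hk hrot rw plateau_decr
    (g' := fun=> 1) _ wcv.
- apply: ae_pos => s Is s0.
  apply: cvg_near_cst; exists (Num.truncn s) => // n /= sn.
  rewrite /plateau s0/= (lt_le_trans (truncnS_gt s))// ler_nat ltnS//.
- exact: lt_le_trans (w0 0%N) (wc 0%N).
- by [].
- move=> f; have [i Hi] := ord_argmin f; exists i.
  apply: (rep_sum_norm_ge (g := fun j => plateau (f j)) (fun j => rw (f j)) (rw (f i))).
    by move=> s; exact: ler0n.
  by move=> j s _ s0; have /andP[] := ple _ _ _ (Hi j) s0.
have c0 : 0 < c by exact: lt_le_trans (w0 0%N) (wc 0%N).
(* Radius [c] suffices for the contradiction: by symmetry [v - w n] has the norm of [v], which is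
   [c]. *)
have [n _] := cl c c0 0%N; rewrite -[X in _ < X]vc.
have mp : measurable_fun I (plateau n) by exact: decr_measurable (plateau_decr n) mI.
have [|||u [ru <-]] := @rep_equi R alpha halpha E fn hE (fun s => 1 - plateau n s) v (fun=> 1) _ _ rv.
- exact: measurable_funB.
- exact: measurable_cst.
- move=> lam l0; rewrite distr_cst1//; case: ifPn => l1.
    apply/eqP; rewrite -leye_eq.
    have <- : mu `[n.+1%:R, +oo[%classic = +oo%E by rewrite lebesgue_measure_itv/= ltry.
    apply: le_measure; rewrite ?inE//.
      apply: measurable_superlevel => //; apply/measurable_EFinP.
      exact: measurable_funB.
    move=> s /=; rewrite in_itv/= andbT => ns; split.
      by split; [exact: le_trans ns|rewrite ainf ltry].
    by rewrite /plateau [s < _]ltNge ns andbF subr0 normr1.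
  rewrite /distr (_ : [set s | _] = set0) ?measure0//; apply/seteqP; split => // s /= [_].
  rewrite lte_fin ltNge => /negP; apply; rewrite leNgt; apply: contra l1 => /lt_le_trans; apply.
  by rewrite /plateau; case: (_ && _); rewrite ?subrr ?normr0 ?subr0 ?normr1.
rewrite (rep_inj hE (rep_sub hE rv (rw n)) ru).
by rewrite ltxx.
Qed.

(** The indicator of the superlevel set is below |x| / lam, hence in E. Were its measure infinite,
    it would be equimeasurable with 1, against [no_unit]. *)
Lemma distr_fin x lam : 0 < lam -> (distr alpha (fn x) lam < +oo)%E.
Proof.
move=> l0; rewrite ltey; apply/negP => /eqP dinf.
have mI := measurable_domI halpha.
have [fx [rx mfx]] := rep_measurable hE x.
have mfx' : measurable_fun I (EFin \o fx) by exact/measurable_EFinP.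
have {}dinf : distr alpha (EFin \o fx) lam = +oo%E.
  by rewrite -dinf; apply: ae_distr => //; [exact: (bfs_measurable hE.1)|
    apply: filterS rx => s xs Is; rewrite xs].
pose A := [set s | I s /\ (lam%:E < `|(fx s)%:E|)%E].
have mA : measurable A by exact: measurable_superlevel.
have [||z [rz _]] := rep_ideal hE (g := \1_A) _ (rep_scale hE lam^-1 rx).
- exact: measurable_indic.
- move=> s Is s0; rewrite indicE normrM.
  have [As|nAs] := boolP (s \in A); last by rewrite normr0 mulr_ge0.
  move: As; rewrite inE => -[_ /=]; rewrite lte_fin => lt.
  by rewrite normr1 [X in _ <= X * _]gtr0_norm ?invr_gt0// ler_pdivlMl// mulr1 ltW.
have [|||u [ru _]] := @rep_equi R alpha halpha E fn hE (fun=> 1) z \1_A _ _ rz.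
- exact: measurable_cst.
- exact: measurable_indic.
- move=> l l'0; rewrite distr_cst1// /distr; case: ifPn => l1.
    rewrite -dinf /distr; congr (mu _); apply/seteqP; split => s /= [Is].
      by move=> As; split => //; rewrite indicE mem_set//= normr1 lte_fin.
    rewrite indicE; have [|] := boolP (s \in A); last by rewrite normr0 lte_fin ltNge l'0.
    by rewrite inE => -[].
  rewrite (_ : [set s | _] = set0) ?measure0//; apply/seteqP; split => // s /= [_].
  rewrite lte_fin ltNge => /negP; apply; rewrite leNgt; apply: contra l1 => /lt_le_trans; apply.
  by rewrite indicE; case: (_ \in _); rewrite ?normr0 ?normr1.
exact: no_unit ru.
Qed.

End profiles.

(** * Decreasing representatives, and indicators of cells *)

Definition cell (R : realType) (n i : nat) : set R :=
  `[i%:R / n%:R, i.+1%:R / n%:R[%classic.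

Arguments cell R n i : clear implicits.

Section decreasing_representatives.
Variables (R : realType) (alpha : \bar R).
Hypothesis halpha : alpha = 1%E \/ alpha = +oo%E.
Variables (E : completeNormedModType R) (fn : E -> R -> \bar R).
Hypothesis hE : symmetric_space alpha fn.
Variable k : nat.
Hypothesis hk : (2 <= k)%N.
Hypothesis hrot : compactly_fully_rotund k (decr_cone alpha fn).

Local Notation mu := (@lebesgue_measure R).
Local Notation I := (domI alpha).
Local Notation rep := (rep alpha fn).

(** Gives access to x^* as a finite real function lying in E with the same norm. The last clause
    says that it tends to 0 at infinity; on [0, 1) this is automatic because it vanishes from 1 on,
    and otherwise it rests on [distr_fin]. *)
Lemma rearr_rep x : exists x' h, [/\ decr_fun alpha h, rep x' h, `|x'| = `|x|,
  forall s : R, 0 < s -> rearr alpha (fn x) s = (h s)%:E &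
  forall e : R, 0 < e -> exists2 T : R, 0 < T & h T <= e].
Proof.
have mx : measurable_fun I (fn x) by exact: (bfs_measurable hE.1).
have mI := measurable_domI halpha.
have dfin e : 0 < e -> (distr alpha (fn x) e < +oo)%E.
  move=> e0; case: (halpha) => ea; last exact: (distr_fin halpha hE hk hrot).
  by apply: le_lt_trans (distr_le_alpha halpha e mx) _; rewrite ea ltry.
have rle lam s : 0 < lam -> (distr alpha (fn x) lam <= s%:E)%E ->
    (rearr alpha (fn x) s <= lam%:E)%E.
  by move=> l0 dl; apply: ereal_inf_lbound; exists lam.
have rfin s : 0 < s -> rearr alpha (fn x) s \is a fin_num.
  move=> s0.
  have [|lam l0 dl] := distr_small halpha mx (bfs_finite hE.1 x) _ s0.
    by exists 1; exact: dfin.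
  rewrite ge0_fin_numE ?rearr_ge0//.
  by apply: le_lt_trans (rle _ _ l0 dl) _; rewrite ltry.
pose h (s : R) := if 0 < s then fine (rearr alpha (fn x) s) else 0.
have hs s : 0 < s -> rearr alpha (fn x) s = (h s)%:E.
  by move=> s0; rewrite /h s0 fineK// rfin.
have h0 s : 0 <= h s.
  by rewrite /h; case: ifP => // s0; rewrite fine_ge0// rearr_ge0.
have dh : decr_fun alpha h.
  split => // [s s0|s t s0 st|s sa].
  - by rewrite /h ltNge s0.
  - have t0 : 0 < t by exact: lt_le_trans st.
    rewrite -lee_fin -!hs//; apply: ereal_inf_le_tmp => _ [l [l0 dl] <-].
    by exists l => //; split => //; apply: le_trans dl _; rewrite lee_fin.
  - have [s0|s0] := ltP 0 s; last by rewrite /h ltNge s0.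
    apply/eqP; rewrite eq_le h0 andbT leNgt; apply/negP.
    rewrite -lte_fin -hs// rearr_gt//; apply/negP; rewrite -leNgt.
    exact: le_trans (distr_le_alpha halpha 0 mx) sa.
have mh : measurable_fun I h by exact: decr_measurable dh mI.
have dd lam : 0 <= lam -> distr alpha (EFin \o h) lam = distr alpha (fn x) lam.
  move=> l0.
  have : (0 <= distr alpha (fn x) lam)%E by exact: measure_ge0.
  have := distr_le_alpha halpha lam mx.
  move Ed : (distr alpha (fn x) lam) => d da d0.
  (* The superlevel set of [h] is exactly the interval from 0 to [d], so [h] and [x] have the same
     distribution. *)
  have S s : I s /\ (lam%:E < `|(h s)%:E|)%E <-> 0 < s /\ (s%:E < d)%E.
    split => [[Is]|[s0 sd]].
      rewrite /= ger0_norm// => lh.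
      have s0 : 0 < s.
        rewrite ltNge; apply/negP => s0; move: lh.
        by rewrite /h (ltNge 0 s) s0/= lte_fin ltNge l0.
      by split => //; rewrite -Ed -rearr_gt// hs.
    split; first by split; [exact: ltW|exact: lt_le_trans da].
    by rewrite /= ger0_norm// -hs// rearr_gt// Ed.
  rewrite /distr; case: d d0 {da Ed} S => [r| |]// r0 S.
  - rewrite (_ : [set s | _] = `]0, r[%classic).
      rewrite lebesgue_measure_itv/= lte_fin; case: ltP => r0'.
        by rewrite oppr0 adde0.
      by congr _%:E; apply/eqP; rewrite eq_le r0' andbT -lee_fin.
    apply/seteqP; split => s; rewrite /= in_itv/= => H.
      by apply/andP; move/S : H; rewrite lte_fin.
    by apply/S; move/andP : H; rewrite lte_fin.
  - rewrite (_ : [set s | _] = `]0, +oo[%classic).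
      by rewrite lebesgue_measure_itv/= ltry.
    apply/seteqP; split => s; rewrite /= in_itv/= andbT => H.
      by case/S : H.
    by apply/S; rewrite ltry.
have [fx [rx mfx]] := rep_measurable hE x.
have [|z [rz nz]] := rep_equi halpha hE mh mfx rx _.
  move=> lam l0; rewrite dd//; apply: ae_distr => //.
    exact/measurable_EFinP.
exists z, h; split => // e e0.
have := dfin e e0.
have : (0 <= distr alpha (fn x) e)%E by exact: measure_ge0.
move Ed : (distr alpha (fn x) e) => [d| |]// d0 _.
(* Adding 1 keeps the point positive when the superlevel set is null. *)
rewrite lee_fin in d0; have d1 : 0 < d + 1 by rewrite ltr_wpDl.
exists (d + 1) => //; rewrite -lee_fin -hs//.
by apply: rle => //; rewrite Ed lee_fin lerDl.
Qed.

Lemma mu_domI : mu I = alpha.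
Proof.
case: halpha => ea.
- rewrite (_ : I = `[0, 1[%classic).
    by rewrite lebesgue_measure_itv/= lte_fin ltr01 ea oppr0 adde0.
  by apply/seteqP; split => s; rewrite /domI ea/= in_itv/= lte_fin => /andP.
- rewrite (_ : I = `[0, +oo[%classic).
    by rewrite lebesgue_measure_itv/= ltry ea.
  apply/seteqP; split => s; rewrite /domI ea/= in_itv/= andbT; first by case.
  by move=> s0; rewrite s0 ltry.
Qed.

(** The weak unit is positive a.e., so its superlevel set at 0 has measure [alpha] and its
    rearrangement [h] is positive at [t]. The indicator is then bounded by [h / h t]. *)
Lemma exists_indic_lt (t : R) : 0 < t -> (t%:E < alpha)%E ->
  exists z, rep z \1_(`[0, t[).
Proof.
move=> t0 ta; have [x x0] := bfs_weak_unit hE.1.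
have mx : measurable_fun I (fn x) by exact: (bfs_measurable hE.1).
have mI := measurable_domI halpha.
have [x' [h [dh rx' _ rh _]]] := rearr_rep x.
have ht : 0 < h t.
  rewrite -lte_fin -rh// rearr_gt//.
  apply: lt_le_trans ta _.
  rewrite -[leLHS]mu_domI.
  apply: le_measure_ae; [exact: mI|exact: (measurable_superlevel halpha 0 mx)|].
  by apply: filterS x0 => s xs Is; split => //; have xs0 := xs Is; rewrite gee0_abs// ltW.
have [||z [rz _]] := rep_ideal hE (g := \1_(`[0, t[)) _ (rep_scale hE (h t)^-1 rx').
- exact: measurable_indic.
- have [h0 hN hd ha] := dh.
  move=> s Is s0; rewrite indicE normrM.
  have [As|nAs] := boolP (s \in _); last by rewrite normr0 mulr_ge0.
  move: As; rewrite inE/= in_itv/= => /andP[_ st].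
  rewrite normr1 [X in _ <= X * _]gtr0_norm ?invr_gt0// ler_pdivlMl// mulr1.
  by rewrite ger0_norm//; apply: hd => //; exact: ltW.
by exists z.
Qed.

Lemma mu_cell n i : (0 < n)%N -> mu (cell R n i) = (n%:R^-1)%:E.
Proof.
move=> n0; rewrite lebesgue_measure_itv/= lte_fin ltr_pM2r ?invr_gt0 ?ltr0n//.
rewrite ltr_nat ltnSn -EFinB -mulrBl; congr (_%:E).
by rewrite -natrB// subSnn mul1r.
Qed.

Lemma cell_domI n i : (0 < n)%N -> ((i.+1%:R / n%:R)%:E <= alpha)%E ->
  cell R n i `<=` I.
Proof.
move=> n0 ia s; rewrite /cell/= in_itv/= => /andP[is_ si]; split.
  by apply: le_trans is_; rewrite divr_ge0.
by apply: lt_le_trans ia; rewrite lte_fin.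
Qed.

Lemma distr_indic (A : set R) lam : A `<=` I -> 0 <= lam ->
  distr alpha (EFin \o \1_A) lam = if lam < 1 then mu A else 0%E.
Proof.
move=> AI l0; rewrite /distr; case: ifPn => l1.
  congr (mu _); apply/seteqP; split => s /=; rewrite indicE.
    case=> _; have [|] := boolP (s \in A); first by rewrite inE.
    by rewrite normr0 lte_fin ltNge l0.
  by move=> As; split; [exact: AI|rewrite mem_set//= normr1 lte_fin].
rewrite (_ : [set s | _] = set0) ?measure0//; apply/seteqP; split => // s /= [_].
rewrite lte_fin ltNge => /negP; apply; rewrite leNgt; apply: contra l1 => /lt_le_trans; apply.
by rewrite indicE; case: (_ \in _); rewrite ?normr0 ?normr1.
Qed.

(** Every cell is equimeasurable with the first one. The bound [2 <= n] makes 1/n strictly less than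
    [alpha] even when [alpha] is 1. *)
Lemma exists_cell n i : (2 <= n)%N -> ((i.+1%:R / n%:R)%:E <= alpha)%E ->
  exists z, rep z \1_(cell R n i).
Proof.
move=> n2 ia; have n0 : (0 < n)%N by exact: leq_trans n2.
have n1 : n%:R^-1 < 1 :> R by rewrite invf_lt1 ?ltr0n// ltr1n.
have a1 : (n%:R^-1%:E < alpha :> \bar R)%E.
  by case: halpha => ->; rewrite ?ltry.
have [z rz] : exists z, rep z \1_(`[0, n%:R^-1[).
  by apply: exists_indic_lt => //; rewrite invr_gt0 ltr0n.
have mc : measurable_fun I (\1_(cell R n i) : R -> R).
  by apply: measurable_indic; exact: measurable_itv.
have mo : measurable_fun I (\1_(`[0, n%:R^-1[) : R -> R).
  exact: measurable_indic.
have [|u [ru _]] := rep_equi halpha hE mc mo rz.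
  move=> lam l0; rewrite !distr_indic//.
  - rewrite mu_cell// lebesgue_measure_itv/= lte_fin invr_gt0 ltr0n n0.
    by rewrite oppr0 adde0.
  - move=> s /=; rewrite in_itv/= => /andP[s0 sn]; split => //.
    by apply: lt_trans a1.
  - exact: cell_domI.
by exists u.
Qed.

End decreasing_representatives.

(** * Majorization *)

(* The classical transfer argument: if [b j > a j] for a first [j], moving
   [min (a i - b i) (b j - a j)] from some earlier [i] with [a i > b i] to [j]
   replaces [a] by a convex combination of [a] and a transposition of [a], and
   creates a new index where [a] and [b] agree. *)
Lemma norm_le_of_majorized (R : realType) (V : normedModType R) (N : nat)
    (e : 'I_N -> V) (b a : 'I_N -> R) :
  (forall i j (c : 'I_N -> R),
    `|\sum_l c (tperm i j l) *: e l| = `|\sum_l c l *: e l|) ->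
  (forall c d : 'I_N -> R, (forall l, 0 <= c l <= d l) ->
    `|\sum_l c l *: e l| <= `|\sum_l d l *: e l|) ->
  (forall i j : 'I_N, (i <= j)%N -> b j <= b i) ->
  (forall l, 0 <= b l) ->
  (forall n, \sum_(l < N | (l < n)%N) b l <= \sum_(l < N | (l < n)%N) a l) ->
  `|\sum_l b l *: e l| <= `|\sum_l a l *: e l|.
Proof.
move=> hperm hmono bd b0.
move: {2}(#|_|) (leqnn #|[pred l | a l != b l]|) => m.
elim: m a => [|m IH] a am pref.
  move: am; rewrite leqn0 => /eqP/card0_eq s0.
  apply: hmono => l; rewrite b0/=.
  by have := s0 l; rewrite !inE => /negbFE/eqP ->.
have [/forallP/= ba|/forallPn/= [j0 j0P]] := boolP [forall l, b l <= a l].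
  by apply: hmono => l; rewrite b0 ba.
case: (@arg_minnP _ j0 (fun l => ~~ (b l <= a l)) val j0P) => j jP jmin.
have bja : a j < b j by rewrite ltNge.
have lej (l : 'I_N) : (l < j)%N -> b l <= a l.
  by move=> lj; apply/negPn/negP => /jmin; rewrite leqNgt lj.
have [i ij iP] : exists2 i : 'I_N, (i < j)%N & b i < a i.
  apply: contrapT => H; have := pref j.+1.
  rewrite (bigD1 j)//= [leRHS](bigD1 j)//= leNgt => /negP; apply.
  rewrite ltr_leD//; apply: ler_sum => l /andP[lj lnj].
  have {lj lnj} lj : (l < j)%N by rewrite ltn_neqAle -ltnS lj andbT.
  by rewrite leNgt; apply/negP => bl; apply: H; exists l.
have nij : i != j by rewrite -val_eqE/= ltn_eqF.
pose d := Num.min (a i - b i) (b j - a j).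
have d0 : 0 < d by rewrite lt_min !subr_gt0 iP bja.
have di : d <= a i - b i by rewrite ge_min lexx.
have dj : d <= b j - a j by rewrite ge_min lexx orbT.
have bji : b j <= b i by apply: bd; exact: ltnW.
pose a' l := a l + d * ((l == j)%:R - (l == i)%:R).
have a'i : a' i = a i - d by rewrite /a' eqxx (negPf nij) sub0r mulrN1.
have a'j : a' j = a j + d by rewrite /a' eqxx eq_sym (negPf nij) subr0 mulr1.
have a'l l : l != i -> l != j -> a' l = a l.
  by move=> li lj; rewrite /a' (negPf li) (negPf lj) subrr mulr0 addr0.
apply: (@le_trans _ _ `|\sum_l a' l *: e l|).
  apply: IH => [|n].
    rewrite -ltnS; apply: leq_trans am; apply: proper_card.
    apply/fintype.properP; split.
      apply/fintype.subsetP => l; rewrite !inE.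
      have [-> _|li] := eqVneq l i; first by rewrite gt_eqF.
      have [-> _|lj] := eqVneq l j; first by rewrite lt_eqF.
      by rewrite a'l.
    have [dE|dE] := leP (a i - b i) (b j - a j).
      exists i; rewrite !inE ?(gt_eqF iP)// a'i /d (min_idPl dE).
      by rewrite opprB addrC subrK eqxx.
    exists j; rewrite !inE ?(lt_eqF bja)// a'j /d (min_idPr (ltW dE)).
    by rewrite addrC subrK eqxx.
  (* A prefix that stops before [j] meets only coordinates where [a'] still dominates [b]; a longer
     one contains both [i] and [j], and its sum has not changed. *)
  have [nj|jn] := leqP n j.
    apply: ler_sum => l ln; have lj : (l < j)%N by exact: leq_trans nj.
    have [->|li] := eqVneq l i; first by rewrite a'i; move: di; lra.
    by rewrite a'l ?lej// -val_eqE/= ltn_eqF.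
  apply: le_trans (pref n) _; rewrite [leRHS]big_split/=.
  rewrite -mulr_sumr sumrB.
  have one (q : 'I_N) : (q < n)%N -> \sum_(l < N | (l < n)%N) (l == q)%:R = 1 :> R.
    move=> qn; rewrite (bigD1 q)//= eqxx big1 ?addr0//.
    by move=> l /andP[_ /negPf ->].
  by rewrite !one ?subrr ?mulr0 ?addr0// (ltn_trans ij).
have aij : 0 < a i - a j by lra.
(* The weight is at most 1 because [b j <= b i]: then a i - a j is at least (a i - b i) + (b j - a
   j), which exceeds [d]. *)
pose t := d / (a i - a j).
have t0 : 0 <= t by rewrite divr_ge0// ltW.
have t1 : t <= 1 by rewrite ler_pdivrMr// mul1r; lra.
have dt : d = t * (a i - a j) by rewrite divfK// gt_eqF.
clearbody t; have a'E l : a' l = (1 - t) * a l + t * a (tperm i j l).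
  have [->|li] := eqVneq l i.
    by rewrite tpermL a'i dt mulrBr mulrBl mul1r opprB addrA addrAC.
  have [->|lj] := eqVneq l j.
    by rewrite tpermR a'j dt mulrBr mulrBl mul1r -addrA [- _ + _]addrC.
  by rewrite tpermD 1?eq_sym// -mulrDl subrK mul1r a'l.
have -> : \sum_l a' l *: e l =
    (1 - t) *: (\sum_l a l *: e l) + t *: (\sum_l a (tperm i j l) *: e l).
  rewrite !scaler_sumr -big_split/=; apply: eq_bigr => l _.
  by rewrite a'E [LHS]scalerDl !scalerA.
apply: le_trans (ler_normD _ _) _; rewrite !normrZ hperm.
rewrite (ger0_norm t0) ger0_norm ?subr_ge0// -mulrDl subrK mul1r//.
Qed.

(** * Step functions on equal cells and their norms *)

Section cells.
Variables (R : realType) (alpha : \bar R).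
Hypothesis halpha : alpha = 1%E \/ alpha = +oo%E.
Variables (E : completeNormedModType R) (fn : E -> R -> \bar R).
Hypothesis hE : symmetric_space alpha fn.

Local Notation mu := (@lebesgue_measure R).
Local Notation I := (domI alpha).
Local Notation rep := (rep alpha fn).

Definition step n N (a : 'I_N -> R) (s : R) : R :=
  \sum_(i < N) a i * \1_(cell R n i) s.

Lemma cell_uniq n i j s : (0 < n)%N -> cell R n i s -> cell R n j s -> i = j.
Proof.
move=> n0; have nR : (0 : R) < n%:R by rewrite ltr0n.
rewrite /cell/= !in_itv/= !ler_pdivrMr// !ltr_pdivlMr//.
move=> /andP[i1 i2] /andP[j1 j2]; apply/eqP; rewrite eqn_leq.
apply/andP; split; rewrite -ltnS -(ltr_nat R).
  exact: le_lt_trans i1 j2.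
exact: le_lt_trans j1 i2.
Qed.

Lemma step_cell n N (a : 'I_N -> R) (i : 'I_N) s : (0 < n)%N ->
  cell R n i s -> step n a s = a i.
Proof.
move=> n0 si; rewrite /step (bigD1 i)//= indicE mem_set// mulr1 big1 ?addr0//.
move=> j ji; rewrite indicE memNset ?mulr0// => sj.
by move/eqP: ji; apply; apply: val_inj; exact: cell_uniq sj si.
Qed.

Lemma step_out n N (a : 'I_N -> R) s : (forall i : 'I_N, ~ cell R n i s) ->
  step n a s = 0.
Proof.
by move=> H; rewrite /step big1// => j _; rewrite indicE memNset ?mulr0.
Qed.

Lemma step_rep n N (e a : 'I_N -> _) :
  (forall i : 'I_N, rep (e i) \1_(cell R n i)) ->
  rep (\sum_(i < N) a i *: e i) (step n a).
Proof. by move=> re; apply: (rep_sum hE) => i; exact: (rep_scale hE). Qed.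

Lemma measurable_step n N (a : 'I_N -> R) : measurable_fun I (step n a).
Proof.
apply: measurable_sum => i; apply: measurable_funM; first exact: measurable_cst.
by apply: measurable_indic; exact: measurable_itv.
Qed.

(** Only the multiset of the |a i| enters, so permuting the coefficients changes neither the
    distribution nor, by symmetry, the norm. This supplies the invariance asked by
    [norm_le_of_majorized]. *)
Lemma distr_step n N (a : 'I_N -> R) lam : (0 < n)%N ->
  ((N%:R / n%:R)%:E <= alpha)%E -> 0 <= lam ->
  distr alpha (EFin \o step n a) lam =
  (\sum_(i < N | (lam < `|a i|)%R) (n%:R^-1)%:E)%E.
Proof.
move=> n0 Na l0.
transitivity (\sum_(i < N | (lam < `|a i|)%R) mu (cell R n i))%E; last first.
  by apply: eq_bigr => i _; rewrite mu_cell.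
have tr : trivIset (fun i : 'I_N => lam < `|a i|) (fun i : 'I_N => cell R n i).
  move=> i j _ _ [s [si sj]].
  by apply: val_inj; exact: cell_uniq si sj.
have mc (i : 'I_N) : lam < `|a i| -> measurable (cell R n i).
  by move=> _; exact: measurable_itv.
rewrite -(measure_bigsetU_ord_cond mu mc tr).
congr (mu _); rewrite -bigcup_pred; apply/seteqP; split => s /=.
    move=> [_]; have [[i si]|H] := pselect (exists i : 'I_N, cell R n i s).
      by rewrite (step_cell a n0 si) lte_fin => la; exists i.
    rewrite step_out ?normr0 ?lte_fin ?ltNge ?l0// => i si.
    by apply: H; exists i.
  move=> [i la si]; rewrite (step_cell a n0 si); split; last exact: la.
  apply: cell_domI si => //; apply: le_trans Na.
  by rewrite lee_fin ler_pM2r ?invr_gt0 ?ltr0n// ler_nat.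
Qed.

Lemma norm_step_le n N (e b a : 'I_N -> _) : (0 < n)%N ->
  ((N%:R / n%:R)%:E <= alpha)%E ->
  (forall i : 'I_N, rep (e i) \1_(cell R n i)) ->
  (forall i j : 'I_N, (i <= j)%N -> b j <= b i) ->
  (forall l, 0 <= b l) ->
  (forall n, \sum_(l < N | (l < n)%N) b l <= \sum_(l < N | (l < n)%N) a l) ->
  `|\sum_l b l *: e l| <= `|\sum_l a l *: e l|.
Proof.
move=> n0 Na re; apply: norm_le_of_majorized.
- move=> i j c.
  have [lam l0|z [rz <-]] := rep_equi halpha hE
      (measurable_step n (fun l => c (tperm i j l))) (measurable_step n c)
      (step_rep c re).
    rewrite !distr_step// [RHS](reindex_inj (@perm_inj _ (tperm i j)))/=.
    exact: eq_bigr.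
  by rewrite (rep_inj hE (step_rep (fun l => c (tperm i j l)) re) rz).
- move=> c d cd; apply: (rep_norm_le hE (step_rep c re) (step_rep d re)).
  move=> s _ _; have [[i si]|H] := pselect (exists i : 'I_N, cell R n i s).
    rewrite !(step_cell _ n0 si); have /andP[c0 cdi] := cd i.
    by rewrite !ger0_norm// (le_trans c0).
  by rewrite !step_out ?normr0// => i si; apply: H; exists i.
Qed.

End cells.

(** * Integrals of decreasing functions *)

(** Extended real, because a decreasing function may fail to be integrable near 0 until
    [itv_int_fin] excludes it. Intervals open on the left concatenate without overlap and avoid the
    singular point. *)
Definition itv_int (R : realType) (h : R -> R) (a b : R) : \bar R :=
  (\int[@lebesgue_measure R]_(s in `]a, b]) (h s)%:E)%E.

Section integral_of_decreasing.
Variables (R : realType) (alpha : \bar R).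
Local Notation mu := (@lebesgue_measure R).
Implicit Types (h : R -> R) (a b c t : R).

Let mdecr h a b : decr_fun alpha h ->
  measurable_fun (`]a, b]%classic : set R) (EFin \o h).
Proof. by move=> dh; apply/measurable_EFinP; exact: decr_measurable dh _. Qed.

Lemma itv_int_ge0 h a b : decr_fun alpha h -> (0 <= itv_int h a b)%E.
Proof. by move=> [h0 _ _ _]; apply: integral_ge0 => s _; rewrite lee_fin. Qed.

Lemma itv_int_split h a b c : decr_fun alpha h -> a <= b -> b <= c ->
  (itv_int h a c = itv_int h a b + itv_int h b c)%E.
Proof.
move=> dh ab bc; have [h0 _ _ _] := dh; rewrite /itv_int.
have -> : `]a, c]%classic = `]a, b]%classic `|` `]b, c]%classic :> set R.
  apply/seteqP; split => s /=; rewrite !in_itv/=.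
    move=> /andP[as_ sc]; have [sb|bs] := leP s b; first by left; rewrite as_.
    by right; rewrite sc.
  case=> /andP[as_ sc]; first by rewrite as_ (le_trans sc).
  by rewrite sc andbT (le_lt_trans ab).
rewrite ge0_integral_setU//=.
- by apply/measurable_EFinP; apply: decr_measurable dh _; exact: measurableU.
- by move=> s _; rewrite lee_fin.
- apply/disj_setPS => s /= []; rewrite !in_itv/= => /andP[_ sb] /andP[bs _].
  by move: bs; rewrite ltNge sb.
Qed.

Lemma itv_int_cst a b c : a <= b -> (itv_int (fun=> c) a b = (c * (b - a))%:E)%E.
Proof.
move=> ab.
have mab : mu (`]a, b]%classic) = (b - a)%:E.
  rewrite lebesgue_measure_itv/= lte_fin; case: ltP => ba; first by rewrite -EFinB.
  by rewrite (_ : a = b) ?subrr//; apply/eqP; rewrite eq_le ab.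
by rewrite /itv_int EFinM -mab; exact: (@integral_cst _ _ _ mu).
Qed.

Lemma le_itv_int_measurable h h' a b : measurable_fun setT h -> measurable_fun setT h' ->
  (forall s, 0 <= h s) -> (forall s, a < s -> s <= b -> h s <= h' s) ->
  (itv_int h a b <= itv_int h' a b)%E.
Proof.
move=> mh mh' h0 hh; apply: ge0_le_integral => //.
- by move=> s _; rewrite lee_fin.
- by apply/measurable_EFinP; exact: measurable_funS mh.
- by apply/measurable_EFinP; exact: measurable_funS mh'.
- by move=> s; rewrite /= in_itv/= => /andP[as_ sb]; rewrite lee_fin hh.
Qed.

Lemma itv_int_le h a b c : decr_fun alpha h -> a <= b ->
  (forall s, a < s -> s <= b -> h s <= c) -> (itv_int h a b <= (c * (b - a))%:E)%E.
Proof.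
move=> dh ab hc; rewrite -itv_int_cst//; have [h0 _ _ _] := dh.
by apply: le_itv_int_measurable => //; exact: decr_measurable dh _.
Qed.

Lemma itv_int_ge h a b c : decr_fun alpha h -> 0 <= c -> a <= b ->
  (forall s, a < s -> s <= b -> c <= h s) -> ((c * (b - a))%:E <= itv_int h a b)%E.
Proof.
move=> dh c0 ab hc; rewrite -itv_int_cst//; have [h0 _ _ _] := dh.
by apply: le_itv_int_measurable => //; exact: decr_measurable dh _.
Qed.

Lemma le_itv_int h h' a b : decr_fun alpha h -> decr_fun alpha h' ->
  (forall s, a < s -> s <= b -> h s <= h' s) -> (itv_int h a b <= itv_int h' a b)%E.
Proof.
move=> dh dh' hh; have [h0 _ _ _] := dh.
by apply: le_itv_int_measurable => //; [exact: decr_measurable dh _|exact: decr_measurable dh' _].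
Qed.

Lemma itv_int_sub h a b c d : decr_fun alpha h -> c <= a -> b <= d ->
  (itv_int h a b <= itv_int h c d)%E.
Proof.
move=> dh ca bd; have [h0 _ _ _] := dh.
apply: ge0_subset_integral => //; first exact: mdecr.
- by move=> s _; rewrite lee_fin.
- move=> s /=; rewrite !in_itv/= => /andP[as_ sb].
  by rewrite (le_lt_trans ca)// (le_trans sb).
Qed.

(** Monotone convergence over growing intervals, valid also when the limit is infinite. It is what
    allows the first cell of a fine subdivision to be dropped. *)
Lemma itv_int_cvg0 h t : decr_fun alpha h ->
  itv_int h n.+1%:R^-1 t @[n --> \oo] --> itv_int h 0 t.
Proof.
move=> dh; have [h0 _ _ _] := dh; rewrite /itv_int.
have -> : `]0, t]%classic = \bigcup_n `]n.+1%:R^-1, t]%classic :> set R.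
  apply/seteqP; split => s /=.
    rewrite in_itv/= => /andP[s0 st].
    exists (Num.truncn s^-1) => //=; rewrite in_itv/= st andbT.
    by rewrite invf_plt ?posrE// truncnS_gt.
  move=> [n _] /=; rewrite !in_itv/= => /andP[ns ->]; rewrite andbT.
  by apply: lt_trans ns; rewrite invr_gt0 ltr0n.
apply: ge0_nondecreasing_set_cvg_integral => //.
- move=> m n mn; apply/subsetPset => s /=; rewrite !in_itv/= => /andP[ms ->].
  rewrite andbT; apply: le_lt_trans ms.
  by rewrite lef_pV2 ?posrE ?ltr0n// ler_nat ltnS.
- by move=> i; exact: mdecr.
- by move=> i s _; rewrite lee_fin.
Qed.

(** The sample at a right endpoint bounds [h] on the next cell, hence the shift: the sum controls
    the integral only from [d] on, since [h] may be unbounded on the first cell. *)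
Lemma itv_int_le_lower_sum h d m : decr_fun alpha h -> 0 < d ->
  (itv_int h d (m.+1%:R * d)%R <= (\sum_(0 <= i < m) h (i.+1%:R * d) * d)%:E)%E.
Proof.
move=> dh d0; have [h0 _ hd _] := dh; elim: m => [|m IH].
  by rewrite big_geq// mul1r /itv_int set_itvoc0// integral_set0.
rewrite (@itv_int_split _ _ (m.+1%:R * d)) //; last 2 first.
- by rewrite ler_peMl ?ler1n// ltW.
- by rewrite ler_pM2r// ler_nat.
rewrite big_nat_recr//= EFinD; apply: leeD => //.
have -> : h (m.+1%:R * d) * d = h (m.+1%:R * d) * (m.+2%:R * d - m.+1%:R * d).
  by rewrite -mulrBl -natrB// subSnn mul1r.
apply: itv_int_le => //; first by rewrite ler_pM2r// ler_nat.
by move=> s ms _; apply: hd; [rewrite mulr_gt0|exact: ltW].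
Qed.

Lemma lower_sum_le_itv_int h d m : decr_fun alpha h -> 0 < d ->
  ((\sum_(0 <= i < m) h (i.+1%:R * d) * d)%:E <= itv_int h 0 (m%:R * d)%R)%E.
Proof.
move=> dh d0; have [h0 _ hd _] := dh; elim: m => [|m IH].
  by rewrite big_geq// (itv_int_ge0 _ _ dh).
rewrite (@itv_int_split _ _ (m%:R * d)) //; last 2 first.
- by rewrite mulr_ge0// ltW.
- by rewrite ler_pM2r// ler_nat.
rewrite big_nat_recr//= EFinD; apply: leeD => //.
have -> : h (m.+1%:R * d) * d = h (m.+1%:R * d) * (m.+1%:R * d - m%:R * d).
  by rewrite -mulrBl -natrB// subSnn mul1r.
apply: itv_int_ge => //; first by rewrite ler_pM2r// ler_nat.
move=> s ms sm; apply: hd => //; apply: le_lt_trans ms.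
by rewrite mulr_ge0// ltW.
Qed.

Lemma itv_int_ext (g h : R -> R) a b : (forall s, a < s -> s <= b -> g s = h s) ->
  itv_int g a b = itv_int h a b.
Proof.
move=> gh; apply: eq_integral => s.
by rewrite inE/= in_itv/= => /andP[as_ sb]; rewrite gh.
Qed.

Lemma itv_int_sum n (g : 'I_n -> R -> R) (a b : R) : (forall i, decr_fun alpha (g i)) ->
  (itv_int (fun s => \sum_(i < n) g i s)%R a b = \sum_(i < n) itv_int (g i) a b)%E.
Proof.
move=> dg; rewrite /itv_int -ge0_integral_sum//.
- by apply: eq_integral => s _; rewrite sumEFin.
- by move=> i; apply/measurable_EFinP; exact: decr_measurable (dg i) _.
- by move=> i s _; rewrite lee_fin; have [] := dg i.
Qed.

Lemma decr_sum n (g : 'I_n -> R -> R) : (forall i, decr_fun alpha (g i)) ->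
  decr_fun alpha (fun s => \sum_(i < n) g i s).
Proof.
move=> dg; split => [s|s s0|s t s0 st|s sa].
- by apply: sumr_ge0 => i _; have [] := dg i.
- by apply: big1 => i _; have [_ ->] := dg i.
- by apply: ler_sum => i _; have [_ _ gd _] := dg i; exact: gd.
- by apply: big1 => i _; have [_ _ _ ->] := dg i.
Qed.

End integral_of_decreasing.

(* Between two consecutive multiples of [M] the prefix sums of [c] are affine
   and those of the nonincreasing sequence [a] are concave. *)
Lemma prefix_sum_blocks (R : realType) (a b : nat -> R) (M N : nat) :
  (0 < M)%N -> (forall i j, (i <= j)%N -> a j <= a i) ->
  (forall q, (q <= N)%N -> \sum_(0 <= i < q * M) b (i %/ M)%N <=
                           \sum_(0 <= i < q * M) a i) ->
  forall m, (m <= N * M)%N ->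
  \sum_(0 <= i < m) b (i %/ M)%N <= \sum_(0 <= i < m) a i.
Proof.
move=> M0 ad blk m mN.
pose q := (m %/ M)%N.
have qm : (q * M <= m)%N by exact: leq_divM.
have mq : (m < q.+1 * M)%N by exact: ltn_ceil.
have bq i : (q * M <= i < q.+1 * M)%N -> b (i %/ M)%N = b q.
  move=> /andP[qi iq]; congr b; apply/eqP; rewrite eqn_leq.
  by rewrite leq_divRL// qi -ltnS ltn_divLR// iq.
have [mE|qN] := leqP N q.
  have -> : m = (N * M)%N.
    by apply/eqP; rewrite eqn_leq mN (leq_trans _ qm)// leq_mul2r mE orbT.
  exact: blk.
(* If [b q] is at most [a m], the terms added since the start of the block favour [a]; otherwise the
   terms remaining up to its end favour [b], and they are subtracted from the inequality at that
   end. *)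
have [bam|abm] := leP (b q) (a m).
  rewrite (big_cat_nat (n := q * M))//= [leRHS](big_cat_nat (n := q * M))//=.
  apply: lerD; first by apply: blk; exact: ltnW.
  rewrite big_nat [leRHS]big_nat; apply: ler_sum => i /andP[qi im].
  rewrite bq ?qi ?(ltn_trans im)//; apply: le_trans bam _.
  by apply: ad; exact: ltnW.
have := blk q.+1 qN.
rewrite (big_cat_nat (n := m))//= ?(ltnW mq)//.
rewrite [leRHS](big_cat_nat (n := m))//= ?(ltnW mq)//.
set A := \sum_(0 <= i < m) a i; set B := \sum_(0 <= i < m) b _.
have : \sum_(m <= i < q.+1 * M) a i <= \sum_(m <= i < q.+1 * M) b (i %/ M)%N.
  rewrite big_nat [leRHS]big_nat; apply: ler_sum => i /andP[mi iq].
  rewrite bq ?iq ?(leq_trans qm)//; apply: le_trans (ltW abm).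
  exact: ad.
lra.
Qed.

(** The factor [1 - e] makes the comparison of integrals strict where the sum is positive, so it
    survives removal of a short interval at 0. Only the finitely many block ends [q <= N] need
    checking, hence one [M] works; [prefix_sum_blocks] fills in the other indices. *)
Lemma eventually_lower_sums_ge (R : realType) (alpha : \bar R) (h : R -> R)
    (b : nat -> R) (n N : nat) (e : R) : decr_fun alpha h -> (0 < n)%N ->
  (forall i, 0 <= b i) -> 0 < e -> e < 1 ->
  (forall q, ((\sum_(0 <= i < q) b i * n%:R^-1)%:E <= itv_int h 0 (q%:R * n%:R^-1)%R)%E) ->
  exists M, (0 < M)%N /\ forall m, (m <= N * M)%N ->
    \sum_(0 <= i < m) (1 - e) * b (i %/ M)%N <=
    \sum_(0 <= i < m) h (i.+1%:R * (n * M)%:R^-1).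
Proof.
move=> dh n0 b0 e0 e1 bJ; have [h0 hN hd ha] := dh.
have nR : (0 : R) < n%:R by rewrite ltr0n.
have key : \forall M \near \oo, forall q : 'I_N.+1,
    (((1 - e) * \sum_(0 <= i < q) b i * n%:R^-1)%:E <=
      itv_int h M.+1%:R^-1 (q%:R * n%:R^-1)%R)%E.
  apply: filter_forall => q.
  have := bJ q; set S := \sum_(0 <= i < q) _ => SJ.
  have S0 : 0 <= S.
    by apply: sumr_ge0 => i _; rewrite mulr_ge0// invr_ge0 ltW.
  have [S00|Sn0] := eqVneq S 0.
    by apply: nearW => M; rewrite S00 mulr0 (itv_int_ge0 _ _ dh).
  have nb : nbhs (itv_int h 0 (q%:R * n%:R^-1)%R) [set x | (((1 - e) * S)%:E < x)%E].
    apply: open_nbhs_nbhs; split; first exact: open_ereal_gt_ereal.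
    apply: lt_le_trans SJ; rewrite lte_fin gtr_pMl; first by lra.
    by rewrite lt_neqAle eq_sym Sn0.
  have nM : \forall M \near \oo,
      (((1 - e) * S)%:E < itv_int h M.+1%:R^-1 (q%:R * n%:R^-1)%R)%E.
    exact: (itv_int_cvg0 dh nb).
  by apply: filterS nM => M /ltW.
have [M0 _ HM] := key.
pose M := M0.+1; exists M; split => // m mN.
apply: (prefix_sum_blocks (a := fun i => h (i.+1%:R * (n * M)%:R^-1))
  (b := fun i => (1 - e) * b i) _ _ _ mN) => //.
  move=> i j ij; apply: hd; first by rewrite mulr_gt0// invr_gt0 ltr0n muln_gt0 n0.
  by rewrite ler_pM2r ?invr_gt0 ?ltr0n ?muln_gt0 ?n0// ler_nat ltnS.
move=> q qN.
pose d : R := (n * M)%:R^-1.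
have d0 : 0 < d by rewrite invr_gt0 ltr0n muln_gt0 n0.
have Md : M%:R * d = n%:R^-1.
  by rewrite /d natrM invfM mulrCA mulfV ?mulr1// pnatr_eq0.
have sumM : \sum_(0 <= i < q * M) (1 - e) * b (i %/ M)%N =
    M%:R * ((1 - e) * \sum_(0 <= i < q) b i).
  elim: (q) => [|p IH]; first by rewrite mul0n !big_geq// !mulr0.
  rewrite (big_cat_nat (n := p * M))//= ?leq_mul2r ?leqnSn ?orbT// IH.
  rewrite [in RHS]big_nat_recr//= !mulrDr; congr (_ + _).
  rewrite (eq_big_nat _ _ (F2 := fun=> (1 - e) * b p)); last first.
    move=> i /andP[pi ip]; congr (_ * b _); apply/eqP; rewrite eqn_leq.
    by rewrite leq_divRL// pi -ltnS ltn_divLR// ip.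
  by rewrite sumr_const_nat mulSn addnK mulr_natl.
rewrite sumM -(ler_pM2r d0) mulrAC Md.
(* Because of the shift by one cell, [q * M] samples control the integral from [d] up to
   [(q * M + 1) * d], which covers the interval in [HM]. *)
rewrite -lee_fin; apply: (@le_trans _ _ (itv_int h d ((q * M).+1%:R * d)%R)); last first.
  by rewrite mulr_suml; exact: (itv_int_le_lower_sum _ dh d0).
have := HM M0 (leqnn M0) (Ordinal (qN : (q < N.+1)%N)).
rewrite /= -mulr_suml mulrA [X in (X%:E <= _)%E]mulrC => /le_trans; apply.
apply: itv_int_sub dh _ _.
  rewrite /d lef_pV2 ?posrE ?ltr0n ?muln_gt0 ?n0// ler_nat.
  by rewrite -/M leq_pmull.
by rewrite -Md mulrA -natrM ler_pM2r// ler_nat.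
Qed.

(** * Full symmetry *)

Section full_symmetry.
Variables (R : realType) (alpha : \bar R).
Hypothesis halpha : alpha = 1%E \/ alpha = +oo%E.
Variables (E : completeNormedModType R) (fn : E -> R -> \bar R).
Hypothesis hE : symmetric_space alpha fn.
Hypothesis hF : fatou_property alpha fn.
Variable k : nat.
Hypothesis hk : (2 <= k)%N.
Hypothesis hrot : compactly_fully_rotund k (decr_cone alpha fn).

Local Notation mu := (@lebesgue_measure R).
Local Notation I := (domI alpha).
Local Notation rep := (rep alpha fn).

Lemma exists_cells n N : (2 <= n)%N -> ((N%:R / n%:R)%:E <= alpha)%E ->
  exists e : 'I_N -> E, forall i : 'I_N, rep (e i) \1_(cell R n i).
Proof.
move=> n2 Na.
have H (i : 'I_N) : exists z, rep z \1_(cell R n i).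
  apply: (exists_cell halpha hE hk hrot) => //; apply: le_trans Na.
  by rewrite lee_fin ler_pM2r ?invr_gt0 ?ltr0n ?ler_nat// (leq_trans _ n2).
by exists (fun i => sval (cid (H i))) => i; exact: (svalP (cid (H i))).
Qed.

Lemma cell_cover n N (s : R) : (0 < n)%N -> 0 <= s -> s < N%:R / n%:R ->
  exists i : 'I_N, cell R n i s.
Proof.
move=> n0 s0; have nR : (0 : R) < n%:R by rewrite ltr0n.
rewrite ltr_pdivlMr// => sN.
have sn0 : 0 <= s * n%:R by rewrite mulr_ge0// ltW.
have /andP[t1 t2] := truncn_itv sn0.
have tN : (Num.truncn (s * n%:R) < N)%N.
  by rewrite -(ltr_nat R); exact: le_lt_trans sN.
exists (Ordinal tN); rewrite /cell/= in_itv/=.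
by rewrite ler_pdivrMr// t1 ltr_pdivlMr.
Qed.

Lemma cell_bounds n N (i : 'I_N) (s : R) : (0 < n)%N -> cell R n i s ->
  0 <= s /\ s < N%:R / n%:R.
Proof.
move=> n0; rewrite /cell/= in_itv/= => /andP[is_ si]; split.
  by apply: le_trans is_; rewrite divr_ge0.
by apply: lt_le_trans si _; rewrite ler_pM2r ?invr_gt0 ?ltr0n// ler_nat.
Qed.

Lemma cell_refine n M i (s : R) : (0 < n)%N -> (0 < M)%N ->
  cell R (n * M) i s -> cell R n (i %/ M) s.
Proof.
move=> n0 M0; have nR : (0 : R) < n%:R by rewrite ltr0n.
have MR : (0 : R) < M%:R by rewrite ltr0n.
have nM : (0 : R) < (n * M)%:R by rewrite ltr0n muln_gt0 n0.
rewrite /cell/= !in_itv/= !ler_pdivrMr// !ltr_pdivlMr//.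
rewrite natrM mulrA => /andP[i1 i2]; apply/andP; split.
  rewrite -(ler_pM2r MR) -natrM; apply: le_trans i1.
  by rewrite ler_nat leq_divM.
rewrite -(ltr_pM2r MR) -natrM; apply: lt_le_trans i2 _.
by rewrite ler_nat -ltn_divLR.
Qed.

Lemma sum_ord_prefix N (a : nat -> R) m :
  \sum_(l < N | (l < m)%N) a l = \sum_(0 <= l < minn m N) a l.
Proof.
have [mN|Nm] := leqP m N.
  by rewrite big_mkord (big_ord_widen _ _ mN).
by rewrite big_mkord; apply: eq_bigl => l; rewrite (ltn_trans _ Nm).
Qed.

(** The fine lower step function of [h] majorizes [1 - d] times the coarse one of [g] and lies
    pointwise below [h]. [L] limits the comparison to finitely many cells inside the interval. *)
Lemma lower_step_norm_le n L g x h : (2 <= n)%N -> (L%:R%:E <= alpha)%E ->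
  decr_fun alpha g -> decr_fun alpha h -> rep x h ->
  (forall t : R, 0 < t -> (itv_int g 0 t <= itv_int h 0 t)%E) ->
  exists z, rep z (step n (fun i : 'I_(L * n) => g (i.+1%:R * n%:R^-1))) /\
    `|z| <= `|x|.
Proof.
move=> n2 La dg dh rx gh; have n0 : (0 < n)%N by exact: leq_trans n2.
have nR : (0 : R) < n%:R by rewrite ltr0n.
have [g0 gN gd ga] := dg; have [h0 hN hd ha] := dh.
pose b i := g (i.+1%:R * n%:R^-1).
have LnE m : (0 < m)%N -> (L * m)%:R / m%:R = L%:R :> R.
  by move=> m0; rewrite natrM mulfK// pnatr_eq0 -lt0n.
have [|e re] := @exists_cells n (L * n) n2; first by rewrite LnE.
pose z := \sum_(i < L * n) b i *: e i.
have rz : rep z (step n (fun i : 'I_(L * n) => b i)) by exact: step_rep.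
exists z; split => //.
suff main (d : R) : 0 < d -> d < 1 -> (1 - d) * `|z| <= `|x|.
  rewrite leNgt; apply/negP => xz.
  have z0 : 0 < `|z| by exact: le_lt_trans xz.
  (* Chosen so that [1 - d] times the norm of [z] is the midpoint of the two norms, still above that
     of [x]. *)
  pose d := (`|z| - `|x|) / (2 * `|z|).
  have dz : d * `|z| = (`|z| - `|x|) / 2 by rewrite /d; field; rewrite gt_eqF.
  have d0 : 0 < d by rewrite divr_gt0 ?subr_gt0// mulr_gt0.
  have d1 : d < 1.
    by rewrite -(ltr_pM2r z0) dz mul1r; have := normr_ge0 x; lra.
  by have := main d d0 d1; rewrite mulrBl mul1r dz; lra.
move=> d0 d1.
have bJ q : ((\sum_(0 <= i < q) b i * n%:R^-1)%:E <= itv_int h 0 (q%:R * n%:R^-1)%R)%E.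
  case: q => [|q]; first by rewrite big_geq// (itv_int_ge0 _ _ dh).
  apply: le_trans (gh _ _); last by rewrite divr_gt0.
  by apply: (lower_sum_le_itv_int _ dg); rewrite invr_gt0.
have [M [M0 HM]] := eventually_lower_sums_ge (L * n) dh n0 (fun i => g0 _) d0 d1 bJ.
have nM0 : (0 < n * M)%N by rewrite muln_gt0 n0.
have nM2 : (2 <= n * M)%N by rewrite (leq_trans n2)// leq_pmulr.
have [|f rf] := @exists_cells (n * M) (L * (n * M)) nM2; first by rewrite LnE.
pose a i := h (i.+1%:R * (n * M)%:R^-1).
pose b' i := (1 - d) * b (i %/ M)%N.
have rb : rep (\sum_(i < L * (n * M)) b' i *: f i)
    (step (n * M) (fun i : 'I_(L * (n * M)) => b' i)) by exact: step_rep.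
have ra : rep (\sum_(i < L * (n * M)) a i *: f i)
    (step (n * M) (fun i : 'I_(L * (n * M)) => a i)) by exact: step_rep.
(* Cutting each cell into [M] pieces keeps the function and repeats each coefficient [M] times, so
   both sides of the majorization have the same number of entries. *)
have zE : (1 - d) *: z = \sum_(i < L * (n * M)) b' i *: f i.
  apply: (rep_inj hE (rep_scale hE (1 - d) rz)).
  apply: (rep_ext rb) => s [s0 _] _.
  have [sL|Ls] := ltP s L%:R.
    have [|i si] := @cell_cover (n * M) (L * (n * M)) s nM0 s0; first by rewrite LnE.
    have iM : (i %/ M < L * n)%N by rewrite ltn_divLR// -mulnA.
    rewrite (step_cell _ nM0 si).
    have sj : cell R n (Ordinal iM) s by exact: cell_refine si.
    by rewrite (step_cell _ n0 sj).
  rewrite !step_out ?mulr0// => i si.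
    by have [_] := cell_bounds n0 si; rewrite LnE// ltNge Ls.
  by have [_] := cell_bounds nM0 si; rewrite LnE// ltNge Ls.
have -> : (1 - d) * `|z| = `|(1 - d) *: z|.
  by rewrite normrZ ger0_norm// subr_ge0 ltW.
rewrite zE; apply: (@le_trans _ _ `|\sum_(i < L * (n * M)) a i *: f i|).
  apply: (norm_step_le halpha hE nM0 _ rf); first by rewrite LnE.
  - move=> i j ij; rewrite /b' ler_pM2l ?subr_gt0//; apply: gd.
      by rewrite divr_gt0.
    by rewrite ler_pM2r ?invr_gt0// ler_nat ltnS leq_div2r.
  - by move=> l; apply: mulr_ge0; [rewrite subr_ge0 ltW|exact: g0].
  - move=> m; rewrite !sum_ord_prefix; apply: HM.
    by rewrite -mulnA geq_minr.
apply: (rep_norm_le hE ra rx) => s Is s0.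
have [[i si]|H] := pselect (exists i : 'I_(L * (n * M)), cell R (n * M) i s).
  rewrite (step_cell _ nM0 si) /a !ger0_norm//; apply: hd => //.
  by move: si; rewrite /cell/= in_itv/= => /andP[_ /ltW].
by rewrite step_out ?normr0// => i si; apply: H; exists i.
Qed.

(** The lower step functions of [g] converge to [g] at its points of right continuity, hence a.e.,
    and their norms are at most that of [x]; [rep_fatou] carries the bound to [y]. *)
Lemma norm_le_of_hlp y g x h : decr_fun alpha g -> decr_fun alpha h ->
  rep y g -> rep x h -> (forall t : R, 0 < t -> (itv_int g 0 t <= itv_int h 0 t)%E) ->
  `|y| <= `|x|.
Proof.
move=> dg dh ry rx gh; have [g0 gN gd ga] := dg.
(* The window [0, L m) is the whole interval when [alpha] is 1 and exhausts it otherwise; the mesh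
   1/(m+2) respects the bound [2 <= n] on cells. *)
pose L m := if alpha == +oo%E then m.+2 else 1%N.
have La m : ((L m)%:R%:E <= alpha)%E.
  by rewrite /L; case: halpha => ->; rewrite ?eqxx ?leey.
have H m := lower_step_norm_le (n := m.+2) isT (La m) dg dh rx gh.
pose z m := sval (cid (H m)).
have rz m : rep (z m) (step m.+2 (fun i : 'I_(L m * m.+2) => g (i.+1%:R * m.+2%:R^-1))).
  exact: (svalP (cid (H m))).1.
have zx m : `|z m| <= `|x| by exact: (svalP (cid (H m))).2.
apply: (rep_fatou hE hF rz zx _ ry).
have pos := ae_pos (alpha := alpha) (P := fun s => 0 < s) (fun _ _ => id).
apply: filterS2 (decr_ae_right_cts dg) pos => s rc s0 Is.
have {}s0 := s0 Is; have {}rc := rc s0.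
apply/cvgrPdist_le => e e0.
have [t st gt] : exists2 t, s < t & g s - e < g t.
  by apply: rc; rewrite ltrBlDr ltrDl.
have ts0 : 0 < t - s by rewrite subr_gt0.
exists (maxn (Num.truncn (t - s)^-1) (Num.truncn s)) => // m /= mm.
have sL : s < (L m)%:R.
  rewrite /L; case: halpha => ea; last first.
    rewrite ea eqxx; apply: lt_le_trans (truncnS_gt s) _.
    rewrite ler_nat ltnS; apply: leq_trans (leq_maxr _ _) _.
    exact: leq_trans mm _.
  by case: Is => _; rewrite ea /= lte_fin.
have [|i si] := @cell_cover m.+2 (L m * m.+2) s (ltn0Sn _) (ltW s0).
  by rewrite natrM mulfK ?pnatr_eq0.
rewrite (step_cell _ (ltn0Sn _) si).
move: si; rewrite /cell/= in_itv/= => /andP[is_ si].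
have gp : g (i.+1%:R / m.+2%:R) <= g s by apply: gd => //; exact: ltW.
have pt : i.+1%:R / m.+2%:R <= t.
  rewrite -natr1 mulrDl mul1r.
  have mt : m.+2%:R^-1 <= t - s.
    rewrite invf_ple ?posrE//; apply: le_trans (ltW (truncnS_gt _)) _.
    rewrite ler_nat ltnS; apply: leq_trans (leq_maxl _ _) _.
    exact: leq_trans mm _.
  by rewrite -(subrK s t) addrC lerD.
have gtp : g t <= g (i.+1%:R / m.+2%:R).
  by apply: gd => //; rewrite divr_gt0.
set p := g (_ / _) in gp gtp *; by rewrite ger0_norm; lra.
Qed.

End full_symmetry.

(** * Order continuity *)

Section order_continuity.
Variables (R : realType) (alpha : \bar R).
Hypothesis halpha : alpha = 1%E \/ alpha = +oo%E.
Variables (E : completeNormedModType R) (fn : E -> R -> \bar R).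
Hypothesis hE : symmetric_space alpha fn.
Hypothesis hF : fatou_property alpha fn.
Variable k : nat.
Hypothesis hk : (2 <= k)%N.
Hypothesis hrot : compactly_fully_rotund k (decr_cone alpha fn).

Local Notation mu := (@lebesgue_measure R).
Local Notation I := (domI alpha).
Local Notation rep := (rep alpha fn).

(** An infinite integral up to [t] is infinite on every ]0, r], since [h] is bounded away from 0.
    Then every multiple of a fixed indicator is dominated by [h], and all these multiples have norm
    at most that of [x], which is impossible. *)
Lemma itv_int_fin x h (t : R) : decr_fun alpha h -> rep x h -> 0 < t ->
  (itv_int h 0 t < +oo)%E.
Proof.
move=> dh rx t0; have [h0 hN hd ha] := dh.
rewrite ltey; apply/negP => /eqP Jinf.
have Joo (r : R) : 0 < r -> itv_int h 0 r = +oo%E.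
  move=> r0; have [tr|rt] := leP t r.
    by apply/eqP; rewrite -leye_eq -Jinf; exact: itv_int_sub dh _ _.
  move: Jinf; rewrite (itv_int_split dh (ltW r0) (ltW rt)).
  have : (itv_int h r t <= (h r * (t - r))%:E)%E.
    by apply: itv_int_le dh (ltW rt) _ => s rs _; apply: hd => //; exact: ltW.
  have := itv_int_ge0 r t dh; have := itv_int_ge0 0 r dh.
  by case: (itv_int h 0 r) => [c| |]//; case: (itv_int h r t) => [d| |].
pose g (s : R) : R := ((0 < s) && (s < 2^-1))%:R.
have half0 : (0 : R) < 2^-1 by rewrite invr_gt0.
have half1 : 2^-1 < 1 :> R by rewrite invf_lt1// ltr1n.
have ha2 : ((2^-1)%:E < alpha)%E by case: halpha => ->; rewrite ?ltry.
have dg (c : R) : 0 <= c -> decr_fun alpha (fun s => c * g s).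
  move=> c0; rewrite /g; split => [s|s s0|s r s0 sr|s sa].
  - by rewrite mulr_ge0.
  - by rewrite ltNge s0 mulr0.
  - apply: ler_wpM2l => //; rewrite s0 (lt_le_trans s0 sr)/=.
    by case: (ltP r) => [/(le_lt_trans sr) ->|_]//; exact: ler0n.
  - have : 2^-1 < s by rewrite -lte_fin; exact: lt_le_trans sa.
    by move=> /ltW; rewrite leNgt => /negPf ->; rewrite andbF mulr0.
have [z rz] := exists_indic_lt halpha hE hk hrot half0 ha2.
have {}rz : rep z g.
  apply: (rep_ext rz) => s _ s0; rewrite indicE /g s0/=; congr (nat_of_bool _)%:R.
  by apply/idP/idP; rewrite inE/= in_itv/= (ltW s0).
have zle (c : R) : 0 <= c -> c * `|z| <= `|x|.
  move=> c0; rewrite -[c in c * _]ger0_norm// -normrZ.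
  apply: (norm_le_of_hlp halpha hE hF hk hrot (dg c c0) dh (rep_scale hE c rz) rx).
  by move=> r r0; rewrite Joo// leey.
have z0 : 0 < `|z|.
  apply: (rep_norm_gt0 hE (s := 2^-1 / 2) (g := fun s => 1 * g s)).
  - by apply: (rep_ext rz) => s _ _; rewrite mul1r.
  - exact: dg.
  - have -> : g (2^-1 / 2) = 1; last by rewrite mulr1.
    by rewrite /g divr_gt0//= gtr_pMr// half1.
have c0 : 0 <= `|x| / `|z| + 1 by rewrite addr_ge0// divr_ge0.
have := zle _ c0; rewrite mulrDl mul1r divfK ?gt_eqF//; lra.
Qed.

Lemma decr_norm_small (z : nat -> E) (g : nat -> R -> R) :
  (forall n, rep (z n) (g n)) -> (forall n, decr_fun alpha (g n)) ->
  (forall s, I s -> 0 < s -> g n s @[n --> \oo] --> 0) ->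
  (forall m n, (m <= n)%N -> `|z n| <= `|z m|) ->
  (forall f : 'I_k -> nat, exists i,
    k%:R * `|z (f i)| <= `|\sum_(i < k) z (f i)|) ->
  forall e : R, 0 < e -> exists n, `|z n| < e.
Proof.
move=> rz dg g0 znd zk e e0; apply: contrapT => H.
have ez n : e <= `|z n| by rewrite leNgt; apply/negP => zn; apply: H; exists n.
have ni : nonincreasing_seq (fun n => `|z n|) by move=> m n; exact: znd.
have cv : cvgn (fun n => `|z n|).
  by apply: nonincreasing_is_cvgn => //; exists e => _ [n _ <-].
have ec : e <= limn (fun n => `|z n|) by apply: limr_ge => //; exact: nearW.
have [||||w [rw wc _]] := rotund_cluster halpha hE hk hrot rz dg
    (g' := fun=> 0) _ cv.
- exact: ae_pos.
- exact: lt_le_trans ec.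
- by move=> n; exact: lt_le_trans (ez n).
- exact: zk.
- by move: ec; rewrite -wc (rep_eq0 hE rw) normr0 leNgt e0.
Qed.

Definition cut_fun (h : R -> R) (t s : R) : R := if s <= t then h s else 0.

Lemma cut_decr h t : decr_fun alpha h -> decr_fun alpha (cut_fun h t).
Proof.
move=> [h0 hN hd ha]; rewrite /cut_fun; split => [s|s s0|s r s0 sr|s sa].
- by case: ifP.
- by rewrite hN// if_same.
- by case: (leP r t) => [/(le_trans sr) ->|_]; [exact: hd|case: ifP].
- by rewrite ha// if_same.
Qed.

Lemma cut_small x h (e : R) : decr_fun alpha h -> rep x h -> 0 < e ->
  exists (t : R) z, [/\ 0 < t, rep z (cut_fun h t) & `|z| < e].
Proof.
move=> dh rx; have [h0 hN hd ha] := dh.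
have H n : exists z, rep z (cut_fun h n.+1%:R^-1) /\ `|z| <= `|x|.
  apply: (rep_ideal hE _ rx).
    exact: decr_measurable (cut_decr _ dh) (measurable_domI halpha).
  by move=> s _ _; rewrite /cut_fun; case: ifP => // _; rewrite normr0.
pose z n := sval (cid (H n)).
have rz n : rep (z n) (cut_fun h n.+1%:R^-1) by exact: (svalP (cid (H n))).1.
have cle m n s : (m <= n)%N -> cut_fun h n.+1%:R^-1 s <= cut_fun h m.+1%:R^-1 s.
  move=> mn; rewrite /cut_fun; case: ifP => [sn|_]; last by case: ifP.
  rewrite (le_trans sn)// lef_pV2 ?posrE ?ltr0n// ler_nat ltnS//.
have c0 n s : 0 <= cut_fun h n.+1%:R^-1 s by have [] := cut_decr n.+1%:R^-1 dh.
move=> e0; have [|||n zn] := decr_norm_small rz (fun n => cut_decr _ dh) _ _ _ e0.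
- move=> s _ s0; apply: cvg_near_cst; exists (Num.truncn s^-1) => // n /= sn.
  rewrite /cut_fun ifF//; apply/negP/negP; rewrite -ltNge invf_plt ?posrE//.
  by apply: lt_le_trans (truncnS_gt _) _; rewrite ler_nat ltnS.
- move=> m n mn; apply: (rep_norm_le hE (rz n) (rz m)) => s _ _.
  by rewrite !ger0_norm// cle.
(* The cuts decrease with the index, so the largest index gives a common minorant of the [k]
   summands. *)
- move=> f; have [i Hi] := ord_argmax hk f; exists i.
  apply: (rep_sum_norm_ge hE (fun j => rz (f j)) (rz (f i))) => // j s _ _.
  exact: cle.
- by exists n.+1%:R^-1, (z n); rewrite invr_gt0 ltr0n.
Qed.

End order_continuity.

(** * Flattening a decreasing function by its mean on an initial interval *)

Section averaging.
Variables (R : realType) (alpha : \bar R).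
Hypothesis halpha : alpha = 1%E \/ alpha = +oo%E.
Variables (E : completeNormedModType R) (fn : E -> R -> \bar R).
Hypothesis hE : symmetric_space alpha fn.
Hypothesis hF : fatou_property alpha fn.
Variable k : nat.
Hypothesis hk : (2 <= k)%N.
Hypothesis hrot : compactly_fully_rotund k (decr_cone alpha fn).

Local Notation mu := (@lebesgue_measure R).
Local Notation I := (domI alpha).
Local Notation rep := (rep alpha fn).

Variables (x : E) (h : R -> R).
Hypothesis dh : decr_fun alpha h.
Hypothesis rx : rep x h.
Hypothesis hlim : forall e : R, 0 < e -> exists2 T : R, 0 < T & h T <= e.

Definition mean (t : R) : R := fine (itv_int h 0 t) / t.

Lemma itv_int_mean t : 0 < t -> itv_int h 0 t = (mean t * t)%:E.
Proof.
move=> t0; rewrite /mean divfK ?gt_eqF// fineK// ge0_fin_numE ?(itv_int_ge0 _ _ dh)//.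
exact: (itv_int_fin halpha hE hF hk hrot dh rx).
Qed.

Lemma le_mean t : 0 < t -> h t <= mean t.
Proof.
move=> t0; have [h0 _ hd _] := dh; rewrite -(ler_pM2r t0) -lee_fin -itv_int_mean//.
rewrite -[X in h t * X]subr0; apply: (itv_int_ge dh) => //; first exact: ltW.
by move=> s s0 st; exact: hd.
Qed.

Lemma mean_split s t : 0 < s -> s <= t ->
  (mean t * t)%:E = ((mean s * s)%:E + itv_int h s t)%E.
Proof.
move=> s0 st; rewrite -!itv_int_mean//; last exact: lt_le_trans st.
by rewrite -(itv_int_split dh)// ltW.
Qed.

Lemma mean_nonincreasing s t : 0 < s -> s <= t -> mean t <= mean s.
Proof.
move=> s0 st; have t0 : 0 < t by exact: lt_le_trans st.
have [h0 _ hd _] := dh.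
rewrite -(ler_pM2r t0) -lee_fin (mean_split s0 st).
have -> : mean s * t = mean s * s + mean s * (t - s) by ring.
rewrite EFinD; apply: leeD => //; apply: (itv_int_le dh) => // u su _.
by apply: le_trans (le_mean s0); apply: hd => //; exact: ltW.
Qed.

(** Past a point [T] where [h] is at most e/2, the integral grows by at most e/2 per unit length,
    and the fixed contribution of ]0, T] is negligible after division by a large [t]. *)
Lemma mean_cvg0 : mean n.+1%:R @[n --> \oo] --> 0.
Proof.
have [h0 _ hd _] := dh.
apply/cvgrPdist_le => e e0; have e2 : 0 < e / 2 by rewrite divr_gt0.
have [T T0 hT] := hlim e2.
have mT0 : 0 <= mean T by exact: le_trans (h0 T) (le_mean T0).
exists (maxn (Num.truncn T) (Num.truncn (mean T * T / (e / 2)))) => // n /= nn.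
set t : R := n.+1%:R.
have t0 : 0 < t by rewrite ltr0n.
have Tt : T <= t.
  apply: le_trans (ltW (truncnS_gt T)) _; rewrite /t ler_nat ltnS.
  exact: leq_trans (leq_maxl _ _) nn.
have Ft : mean T * T <= e / 2 * t.
  rewrite [leRHS]mulrC -ler_pdivrMr//.
  apply: le_trans (ltW (truncnS_gt _)) _; rewrite /t ler_nat ltnS.
  exact: leq_trans (leq_maxr _ _) nn.
rewrite sub0r normrN ger0_norm; last exact: le_trans (h0 t) (le_mean t0).
rewrite -(ler_pM2r t0) -lee_fin (mean_split T0 Tt).
apply: (@le_trans _ _ ((mean T * T)%:E + (e / 2 * (t - T))%:E)%E).
  apply: leeD => //; apply: (itv_int_le dh) => // u Tu _.
  by apply: le_trans hT; apply: hd => //; exact: ltW.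
rewrite -EFinD lee_fin; have : 0 <= e / 2 * T by rewrite mulr_ge0 ?ltW.
by move: Ft; lra.
Qed.

Definition flatten_fun (t s : R) : R :=
  if s <= 0 then 0 else if s <= t then mean t else h s.

Hypothesis ainf : alpha = +oo%E.

Lemma flatten_decr t : 0 < t -> decr_fun alpha (flatten_fun t).
Proof.
move=> t0; have [h0 _ hd _] := dh; have mt := le_mean t0.
rewrite /flatten_fun; split => [s|s ->//|s r s0 sr|s].
- by case: ifP => // _; case: ifP => // _; exact: le_trans mt.
- rewrite [r <= 0]leNgt [s <= 0]leNgt s0 (lt_le_trans s0 sr)/=.
  have [rt|tr] := leP r t; first by rewrite (le_trans sr rt).
  have [st|ts] := leP s t; last exact: hd.
  by apply: le_trans mt; apply: hd => //; exact: ltW.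
- by rewrite ainf leye_eq.
Qed.

Lemma itv_int_flatten_le t r : 0 < t -> 0 < r -> r <= t ->
  itv_int (flatten_fun t) 0 r = (mean t * r)%:E.
Proof.
move=> t0 r0 rt; rewrite -[X in (_ * X)%:E]subr0 -(itv_int_cst _ (ltW r0)).
apply: itv_int_ext => s s0 sr.
by rewrite /flatten_fun leNgt s0/= (le_trans sr rt).
Qed.

Lemma itv_int_flatten_ge t r : 0 < t -> t <= r ->
  itv_int (flatten_fun t) 0 r = (mean r * r)%:E.
Proof.
move=> t0 tr; rewrite (itv_int_split (flatten_decr t0) (ltW t0) tr).
rewrite itv_int_flatten_le// (mean_split t0 tr); congr (_ + _)%E.
apply: itv_int_ext => s ts _.
by rewrite /flatten_fun [s <= 0]leNgt (lt_trans t0 ts)/= leNgt ts.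
Qed.

Lemma itv_int_flatten_anti s t r : 0 < s -> s <= t -> 0 < r ->
  (itv_int (flatten_fun t) 0 r <= itv_int (flatten_fun s) 0 r)%E.
Proof.
move=> s0 st r0; have t0 : 0 < t by exact: lt_le_trans st.
have [rs|sr] := leP r s.
  rewrite !itv_int_flatten_le// ?(le_trans rs)// lee_fin ler_pM2r//.
  exact: mean_nonincreasing.
rewrite (itv_int_flatten_ge s0 (ltW sr)).
have [rt|tr] := leP r t; last by rewrite itv_int_flatten_ge// ltW.
by rewrite itv_int_flatten_le// lee_fin ler_pM2r//; exact: mean_nonincreasing.
Qed.

Lemma flatten_rep t : 0 < t -> exists z, rep z (flatten_fun t).
Proof.
move=> t0; have [h0 _ _ _] := dh.
have t1 : 0 < t + 1 by rewrite addr_gt0.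
(* The indicator is half-open, so it is taken slightly longer to include the point [t]. *)
have [q rq] : exists q, rep q \1_(`[0, (t + 1)[).
  by apply: (exists_indic_lt halpha hE hk hrot) => //; rewrite ainf ltry.
have mo : measurable_fun I (flatten_fun t).
  exact: decr_measurable (flatten_decr t0) (measurable_domI halpha).
have mt0 : 0 <= mean t by exact: le_trans (le_mean t0).
have [|z [rz zb]] := rep_ideal hE mo (rep_add hE (rep_scale hE (mean t) rq) rx).
  move=> s _ s0; rewrite /flatten_fun [s <= 0]leNgt s0/= !ger0_norm; last first.
  - by case: ifP.
  - by rewrite addr_ge0// mulr_ge0.
  have [st|ts] := leP s t; last by rewrite lerDr mulr_ge0.
  rewrite indicE mem_set ?mulr1 ?lerDl//= in_itv/= (ltW s0)/=.
  by rewrite (le_lt_trans st)// ltrDl.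
by exists z.
Qed.

(** Flattened functions need not be ordered pointwise, so the [k]-fold sums are compared through
    integrals: sums of decreasing functions are decreasing and their integrals add up, which lets
    [norm_le_of_hlp] be applied to the sums themselves. *)
Lemma flatten_small (e : R) : 0 < e ->
  exists (t : R) z, [/\ 0 < t, rep z (flatten_fun t) & `|z| < e].
Proof.
have n0 n : (0 : R) < n.+1%:R by rewrite ltr0n.
pose z n := sval (cid (flatten_rep (n0 n))).
have rz n : rep (z n) (flatten_fun n.+1%:R).
  exact: (svalP (cid (flatten_rep (n0 n)))).
have dz n := flatten_decr (n0 n).
have le_flat (m n : nat) r : (m <= n)%N -> 0 < r ->
    (itv_int (flatten_fun n.+1%:R) 0 r <= itv_int (flatten_fun m.+1%:R) 0 r)%E.
  by move=> mn r0; apply: itv_int_flatten_anti => //; rewrite ler_nat.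
move=> e0.
have [|||n zn] := decr_norm_small halpha hE hk hrot rz dz _ _ _ e0; last first.
- by exists n.+1%:R, (z n).
- move=> f; have [i Hi] := ord_argmax hk f; exists i.
  have -> : k%:R * `|z (f i)| = `|\sum_(j < k) z (f i)|.
    by rewrite sumr_const card_ord -(scaler_nat k (z (f i))) normrZ ger0_norm.
  apply: (norm_le_of_hlp halpha hE hF hk hrot
      (decr_sum (fun j : 'I_k => dz (f i))) (decr_sum (fun j : 'I_k => dz (f j)))
      (rep_sum hE (fun j : 'I_k => rz (f i)))
      (rep_sum hE (fun j : 'I_k => rz (f j)))) => r r0.
  rewrite (itv_int_sum _ _ (fun j : 'I_k => dz (f i))).
  rewrite (itv_int_sum _ _ (fun j : 'I_k => dz (f j))).
  by apply: lee_sum => j _; exact: le_flat.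
- move=> m n mn.
  apply: (norm_le_of_hlp halpha hE hF hk hrot (dz n) (dz m) (rz n) (rz m)).
  by move=> r r0; exact: le_flat.
- move=> s _ s0; have mc := mean_cvg0.
  apply: cvg_trans mc; apply: near_eq_cvg.
  exists (Num.truncn s) => // n /= sn.
  rewrite /flatten_fun [s <= 0]leNgt s0/= ifT//.
  by apply: le_trans (ltW (truncnS_gt s)) _; rewrite ler_nat ltnS.
Qed.

Lemma mean_gt0 s t : 0 < s -> 0 < h s -> 0 < t -> 0 < mean t.
Proof.
move=> s0 hs t0; have [h0 _ hd _] := dh.
have [st|ts] := leP s t; last first.
  by apply: lt_le_trans (le_mean t0); apply: lt_le_trans hs _; exact/hd/ltW.
rewrite -(pmulr_lgt0 _ t0) -lte_fin (mean_split s0 st).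
apply: (@lt_le_trans _ _ (mean s * s)%:E); last by rewrite leeDl// (itv_int_ge0 _ _ dh).
by rewrite lte_fin mulr_gt0// (lt_le_trans hs)// le_mean.
Qed.

(** With [d] the mean of [h] on ]0, t], the bound on [b] gives the comparison with the flattened [h]
    up to [t]. Beyond [t], flattening no longer changes the integral, and the hypothesis on [h]
    takes over. *)
Lemma small_of_bounded_infinite s (e : R) : 0 < s -> 0 < h s -> 0 < e ->
  exists2 d : R, 0 < d & forall y b, decr_fun alpha b -> rep y b ->
    (forall t : R, 0 < t -> (itv_int b 0 t <= itv_int h 0 t)%E) ->
    (forall u, b u <= d) -> `|y| <= e.
Proof.
move=> s0 hs e0; have [t [z [t0 rz ze]]] := flatten_small e0.
exists (mean t); first exact: mean_gt0 hs t0.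
move=> y b db ry bh bd; apply: le_trans (ltW ze).
apply: (norm_le_of_hlp halpha hE hF hk hrot db (flatten_decr t0) ry rz) => r r0.
have [rt|tr] := leP r t; last by rewrite itv_int_flatten_ge ?(ltW tr)// -itv_int_mean// bh.
rewrite itv_int_flatten_le// -[X in (_ * X)%:E]subr0.
by apply: (itv_int_le db (ltW r0)) => u _ _.
Qed.

End averaging.

(** * Splitting a dominated function, and the conclusion *)

Section domination.
Variables (R : realType) (alpha : \bar R).
Hypothesis halpha : alpha = 1%E \/ alpha = +oo%E.
Variables (E : completeNormedModType R) (fn : E -> R -> \bar R).
Hypothesis hE : symmetric_space alpha fn.
Hypothesis hF : fatou_property alpha fn.
Variable k : nat.
Hypothesis hk : (2 <= k)%N.
Hypothesis hrot : compactly_fully_rotund k (decr_cone alpha fn).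

Local Notation mu := (@lebesgue_measure R).
Local Notation I := (domI alpha).
Local Notation rep := (rep alpha fn).

Lemma small_of_bounded x h s (e : R) : decr_fun alpha h -> rep x h ->
  (forall d : R, 0 < d -> exists2 T : R, 0 < T & h T <= d) ->
  0 < s -> 0 < h s -> 0 < e ->
  exists2 d : R, 0 < d & forall y b, decr_fun alpha b -> rep y b ->
    (forall t : R, 0 < t -> (itv_int b 0 t <= itv_int h 0 t)%E) ->
    (forall u, b u <= d) -> `|y| <= e.
Proof.
move=> dh rx hlim s0 hs e0; case: (halpha) => ea; last first.
  exact: (small_of_bounded_infinite halpha hE hF hk hrot dh rx hlim ea s0 hs e0).
(* On [0, 1) constants belong to E, so a uniform bound is enough; 1 is built from two half cells
   because cells are available only for [2 <= n]. *)
have [|o ro] := exists_cells halpha hE hk hrot (n := 2) (N := 2) isT.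
  by rewrite ea lee_fin divff.
have {}ro := step_rep hE (fun=> 1) ro.
pose z := \sum_(i < 2) (1 : R) *: o i.
exists (e / (`|z| + 1)); first by rewrite divr_gt0// ltr_wpDl.
move=> y b db ry _ bd; have [b0 _ _ _] := db.
have z1 : 0 < `|z| + 1 by rewrite ltr_wpDl.
apply: (@le_trans _ _ `|(e / (`|z| + 1)) *: z|).
  apply: (rep_norm_le hE ry (rep_scale hE _ ro)) => u [u0 ua] _.
  have [|i ui] := @cell_cover R 2 2 u isT u0.
    by rewrite divff// -lte_fin -ea.
  rewrite (step_cell _ _ ui)// mulr1 !ger0_norm//.
  by rewrite divr_ge0// ltW.
rewrite normrZ ger0_norm; last by rewrite divr_ge0// ltW.
by rewrite -mulrAC ler_pdivrMr// ler_pM2l// lerDl.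
Qed.

(** The closed and the half-open interval differ by the origin, where f^* may be infinite. *)
Lemma itv_int_rearr (f : R -> \bar R) h (t : R) : decr_fun alpha h ->
  (forall s : R, 0 < s -> rearr alpha f s = (h s)%:E) ->
  (\int[mu]_(s in `[0%R, t]) rearr alpha f s)%E = itv_int h 0 t.
Proof.
move=> dh fh.
have E1 s : `]0, t]%classic s -> rearr alpha f s = (h s)%:E.
  by rewrite /= in_itv/= => /andP[s0 _]; exact: fh.
rewrite -integral_itv_obnd_cbnd.
  by apply: eq_integral => s; rewrite inE => /E1.
apply: (eq_measurable_fun (EFin \o h)).
  by move=> s; rewrite inE => /E1.
by apply/measurable_EFinP; exact: decr_measurable dh _.
Qed.

Lemma hlp_le_itv_int (f f' : R -> \bar R) g h : decr_fun alpha g -> decr_fun alpha h ->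
  (forall s : R, 0 < s -> rearr alpha f s = (g s)%:E) ->
  (forall s : R, 0 < s -> rearr alpha f' s = (h s)%:E) ->
  hlp_le alpha f f' -> forall t : R, 0 < t -> (itv_int g 0 t <= itv_int h 0 t)%E.
Proof.
move=> dg dh fg fh ff' t t0; have := ff' t t0.
rewrite /maxrearr (itv_int_rearr t dg fg) (itv_int_rearr t dh fh) lee_pmul2l//.
by rewrite lte_fin invr_gt0.
Qed.

(* A profile [b] splits as the excess over its value at [t], which is dominated
   by [h] cut at [t], and the part truncated at that value. *)
Lemma norm_le_split x h y b (t e d : R) z : decr_fun alpha h -> rep x h ->
  decr_fun alpha b -> rep y b ->
  (forall r : R, 0 < r -> (itv_int b 0 r <= itv_int h 0 r)%E) ->
  0 < t -> rep z (cut_fun h t) ->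
  (forall y' b', decr_fun alpha b' -> rep y' b' ->
    (forall r : R, 0 < r -> (itv_int b' 0 r <= itv_int h 0 r)%E) ->
    (forall u, b' u <= d) -> `|y'| <= e) ->
  b t <= d -> `|y| <= `|z| + e.
Proof.
move=> dh rx db ry bh t0 rz small btd; have [b0 bN bd ba] := db.
have mI := measurable_domI halpha.
pose top s := Num.max (b s - b t) 0.
pose low s := Num.min (b s) (b t).
have topb s : top s <= b s by rewrite /top ge_max b0 andbT lerBlDr lerDl.
have top0 s : 0 <= top s by rewrite /top le_max lexx orbT.
have low0 s : 0 <= low s by rewrite /low le_min !b0.
have lowb s : low s <= b s by rewrite /low ge_min lexx.
have dtop : decr_fun alpha top.
  split => // [s s0|s r s0 sr|s sa].
  - by apply/eqP; rewrite eq_le top0 andbT -(bN s s0).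
  - by rewrite /top ge_max !le_max lexx orbT andbT lerB// bd.
  - by apply/eqP; rewrite eq_le top0 andbT -(ba s sa).
have dlow : decr_fun alpha low.
  split => // [s s0|s r s0 sr|s sa].
  - by apply/eqP; rewrite eq_le low0 andbT -(bN s s0).
  - by rewrite /low le_min !ge_min lexx orbT andbT bd.
  - by apply/eqP; rewrite eq_le low0 andbT -(ba s sa).
have [|yt [rt _]] := rep_ideal hE (decr_measurable dtop mI) ry.
  by move=> s _ _; rewrite !ger0_norm.
have [|yl [rl _]] := rep_ideal hE (decr_measurable dlow mI) ry.
  by move=> s _ _; rewrite !ger0_norm.
have -> : y = yt + yl.
  apply: (rep_inj hE ry); apply: rep_ext (rep_add hE rt rl) _ => s _ _.
  rewrite /top /low; case: (leP (b s) (b t)) => bst.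
    by rewrite (max_idPr _) ?add0r// subr_le0.
  by rewrite (max_idPl _) ?subrK// subr_ge0 ltW.
apply: le_trans (ler_normD _ _) _; apply: lerD.
  apply: (norm_le_of_hlp halpha hE hF hk hrot dtop (cut_decr t dh) rt rz) => r r0.
  have step1 (q : R) : 0 < q -> q <= t -> (itv_int top 0 q <= itv_int (cut_fun h t) 0 q)%E.
    move=> q0 qt; rewrite (_ : itv_int (cut_fun h t) 0 q = itv_int h 0 q).
      by apply: le_trans (bh q q0); exact: (le_itv_int dtop db).
    by apply: itv_int_ext => s _ sq; rewrite /cut_fun (le_trans sq qt).
  have [rt'|tr] := leP r t; first exact: step1.
  rewrite (itv_int_split dtop (ltW t0) (ltW tr)).
  have -> : itv_int top t r = 0%E.
    apply/eqP; rewrite eq_le (itv_int_ge0 _ _ dtop) andbT.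
    have -> : 0%E = (0 * (r - t))%:E by rewrite mul0r.
    apply: (itv_int_le dtop (ltW tr)) => s ts _.
    by rewrite /top ge_max lexx andbT subr_le0 bd// ltW.
  rewrite adde0; apply: le_trans (step1 t t0 (lexx t)) _.
  by apply: (itv_int_sub (cut_decr t dh)) => //; exact: ltW.
apply: (small yl low) => // [r r0|u].
  by apply: le_trans (bh r r0); exact: (le_itv_int dlow db).
by rewrite /low ge_min btd orbT.
Qed.

End domination.

Theorem corollary5p9 (R : realType) (alpha : \bar R)
    (halpha : alpha = 1%E \/ alpha = +oo%E)
    (k : nat) (hk : (2 <= k)%N)
    (E : completeNormedModType R) (fn : E -> R -> \bar R)
    (hE : symmetric_space alpha fn) (hF : fatou_property alpha fn)
    (hrot : compactly_fully_rotund k (decr_cone alpha fn)) :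
  K_order_continuous alpha fn.
Proof.
move=> x u ux u0.
have [x' [h [dh rx _ xh hlim]]] := rearr_rep halpha hE hk hrot x.
have H n := rearr_rep halpha hE hk hrot (u n).
have Jle n y g : decr_fun alpha g ->
    (forall s : R, 0 < s -> rearr alpha (fn (u n)) s = (g s)%:E) ->
    rep alpha fn y g -> forall t : R, 0 < t -> (itv_int g 0 t <= itv_int h 0 t)%E.
  by move=> dg ug _; exact: hlp_le_itv_int dg dh ug xh (ux n).
(* If [h] vanishes, every [u n] is dominated by 0 and has norm 0. Otherwise the means of [h] are
   positive, as the choice of [d] below requires. *)
have [[s s0 hs]|h0] := pselect (exists2 s, 0 < s & 0 < h s); last first.
  have x0 : x' = 0.
    apply: (rep_eq0 hE); apply: (rep_ext rx) => s _ s0.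
    have [hge _ _ _] := dh; apply/eqP; rewrite eq_le hge andbT leNgt.
    by apply/negP => hs; apply: h0; exists s.
  apply: cvg_near_cst; apply: nearW => n.
  have [y [g [dg ry <- ug _]]] := H n.
  apply/eqP; rewrite eq_le normr_ge0 andbT -(normr0 E) -x0.
  exact: (norm_le_of_hlp halpha hE hF hk hrot dg dh ry rx (Jle _ _ _ dg ug ry)).
apply/cvgrPdist_le => e e0; have e2 : 0 < e / 2 by rewrite divr_gt0.
have [t [z [t0 rz ze]]] := cut_small halpha hE hk hrot dh rx e2.
have [d d0 small] := small_of_bounded halpha hE hF hk hrot dh rx hlim s0 hs e2.
(* Convergence may fail at [t] itself, so a point [r] before [t] is used, where the decreasing
   profile is at least as large; [r < 1/2] keeps it inside the interval. *)
have [r /andP[r0 rt] ur] : exists2 r, 0 < r < Num.min t (2^-1) &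
    domI alpha r -> rearr alpha (fn (u n)) r @[n --> \oo] --> 0%E.
  by apply: (ae_exists_itv u0); rewrite lt_min t0 invr_gt0/=.
move: rt; rewrite lt_min => /andP[rt r2].
have rI : domI alpha r.
  split; first exact: ltW.
  case: halpha => ->; last exact: ltry.
  by rewrite lte_fin (lt_trans r2)// invf_lt1// ltr1n.
have nb : nbhs (0%E : \bar R) [set x | (x < d%:E)%E].
  apply: open_nbhs_nbhs; split; first exact: open_ereal_lt_ereal.
  by rewrite /= lte_fin.
have near_d : \forall n \near \oo, (rearr alpha (fn (u n)) r < d%:E)%E.
  exact: (ur rI _ nb).
apply: filterS near_d => n und.
have [y [g [dg ry <- ug _]]] := H n.
rewrite sub0r normrN normr_id.
apply: (@le_trans _ _ (`|z| + e / 2)); last by move: ze; lra.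
apply: (norm_le_split halpha hE hF hk hrot dh rx dg ry (Jle _ _ _ dg ug ry) t0 rz small).
apply: (@le_trans _ _ (g r)); first by have [_ _ gd _] := dg; exact/gd/ltW.
by rewrite -lee_fin -ug// ltW.
Qed.
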